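(* Let $1<p<2$ and let $\varphi:\mathbb{D}\to\mathbb{D}$ be analytic. Then the composition operator $C_\varphi$ is an isometry on $B_p$ (with the norm $\|\cdot\|_{B_p}$) if and only if $\varphi$ is a rotation of the disk, i.e. $\varphi(z)=\lambda z$ for some $\lambda\in\mathbb{C}$ with $|\lambda|=1$.
   Context: $\mathbb{D}=\{z\in\mathbb{C}:|z|<1\}$, $H(\mathbb{D})$ is the set of analytic functions on $\mathbb{D}$, and $dA$ is Lebesgue area measure on $\mathbb{D}$ normalized so that $A(\mathbb{D})=1$. For $1<p<\infty$ and $f\in H(\mathbb{D})$ put $\|f\|_p^p=\int_{\mathbb{D}}|f'(z)|^p(1-|z|^2)^{p-2}\,dA(z)$; the analytic Besov space is $B_p=\{f\in H(\mathbb{D}):\|f\|_p<\infty\}$, a Banach space with norm $\|f\|_{B_p}=|f(0)|+\|f\|_p$. For an analytic $\varphi:\mathbb{D}\to\mathbb{D}$, $C_\varphi f=f\circ\varphi$. ''$C_\varphi$ is an isometry on $B_p$'' means that for every $f\in B_p$, $f\circ\varphi\in B_p$ and $\|f\circ\varphi\|_{B_p}=\|f\|_{B_p}$ (surjectivity is not required). *)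

(* Defs.v *)
From HB Require Import structures.
From mathcomp Require Import all_boot all_order all_algebra.
From mathcomp Require Import complex.
From mathcomp Require Import all_classical all_reals all_analysis.
Import Order.TTheory GRing.Theory Num.Theory.
Import numFieldNormedType.Exports.

Set Implicit Arguments.
Unset Strict Implicit.
Unset Printing Implicit Defensive.

Local Open Scope ring_scope.
Local Open Scope classical_set_scope.

(* Typing [R[i]] as a numFieldType gives it the norm topology and the complex
   differentiation that MathComp-Analysis provides for every numFieldType.  In
   that structure the norm [`|z|] is an element of [R[i]], namely [(cabs z)%:C]
   for the [R]-valued modulus [cabs] below. *)
Definition Cplx (R : realType) : numFieldType := R[i].

Section Besov.
Context {R : realType}.

Definition cabs (z : Cplx R) : R := Normc.normc z.

Definition xy_to_C (w : R * R) : Cplx R := (w.1 +i* w.2)%C.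

Definition disk : set (Cplx R) := [set z | cabs z < 1].

(* A function on the disk is represented by a total function on the plane whose
   values off the disk are irrelevant: the disk is open, so differentiability
   and the derivative at its points only depend on values in the disk. *)
Definition analytic : set (Cplx R -> Cplx R) :=
  [set f | forall z, disk z -> derivable f z 1].

Lemma invr_pi_ge0 : 0 <= (pi : R)^-1.
Proof. by rewrite invr_ge0 pi_ge0. Qed.

(* The unit disk has Lebesgue measure [pi], so its [area] is 1. *)
Definition area :
    {measure set (measurableTypeR R * measurableTypeR R) -> \bar R} :=
  mscale (NngNum invr_pi_ge0)
    (@lebesgue_measure R \x @lebesgue_measure R)%E.

Definition besov_integral (p : R) (f : Cplx R -> Cplx R) : \bar R :=
  (\int[area]_(w in xy_to_C @^-1` disk)
     (cabs (derive1 f (xy_to_C w)) `^ p *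
      (1 - cabs (xy_to_C w) ^+ 2) `^ (p - 2))%:E)%E.

Definition besov_seminorm (p : R) (f : Cplx R -> Cplx R) : \bar R :=
  (besov_integral p f `^ p^-1)%E.

Definition besov_norm (p : R) (f : Cplx R -> Cplx R) : \bar R :=
  ((cabs (f 0))%:E + besov_seminorm p f)%E.

Definition besov (p : R) : set (Cplx R -> Cplx R) :=
  analytic `&` [set f | (besov_seminorm p f < +oo)%E].

Definition comp_op (phi f : Cplx R -> Cplx R) : Cplx R -> Cplx R := f \o phi.

Definition besov_isometry (p : R) (T : (Cplx R -> Cplx R) -> Cplx R -> Cplx R) :=
  forall f, besov p f -> besov p (T f) /\ besov_norm p (T f) = besov_norm p f.

End Besov.

(* Main.v *)
(** A composition operator that is an isometry fixes the origin: test it on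
    [z - a] for [a = 0] and [a = phi 0].  Testing it on the powers [(z - a)^n]
    shows that all moments [int |w - a|^(pn)] of [(1-|w|^2)^(p-2) dA] and of the
    push-forward under [phi] of [|phi'|^p (1-|z|^2)^(p-2) dA] agree, hence so do
    the integrals of the bumps [(1 - (|w - a|/2)^p)^N].  As [N] grows the bumps
    concentrate at [a]; for [a = phi b] with [phi' b <> 0], comparing the
    densities at [a] gives
    [(|phi' b| (1-|b|^2))^(p-2) <= (1-|a|^2)^(p-2)], that is, since [p < 2], the
    reverse Schwarz-Pick inequality [1-|phi b|^2 <= |phi' b| (1-|b|^2)].
    By continuity along a ray [|phi' 0| >= 1], and [phi] is a rotation by the
    equality case of the Schwarz lemma.

    The Cauchy theory needed for this comes from Goursat's bisection in the
    logarithmic coordinates [c + e^(s+it)], which yields the mean value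
    property, and the invariance of area from the factorization of a similarity
    into two shears. *)
Require Import Defs.
From HB Require Import structures.
From mathcomp Require Import all_boot all_order all_algebra.
From mathcomp Require Import complex ring lra.
From mathcomp Require Import all_classical all_reals all_analysis.
From mathcomp Require Import measurable_realfun.
Import Order.TTheory GRing.Theory Num.Theory.
Import numFieldNormedType.Exports.

Set Implicit Arguments.
Unset Strict Implicit.
Unset Printing Implicit Defensive.

Local Open Scope ring_scope.
Local Open Scope classical_set_scope.

(** * Complex modulus and derivative *)

(** The tests only see distances to one point, so they give no change of variables for [phi]; what
    they allow is a comparison of local densities. Near [b] only the mass of a small ball around [b]
    is counted. Other preimages of points near [phi b] could only add nonnegative mass, so the
    comparison is one-sided, and the negative exponent [p - 2] turns that side into the direction
    opposite to Schwarz-Pick. The hypothesis [1 < p] makes the weight integrable, which puts the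
    test powers in the space and allows integrals to be cancelled.

    The reverse inequality is obtained only where [phi'] does not vanish, but it is wanted at 0.
    Along the ray from 0 to a point with nonzero derivative, the quotient of its two sides is
    continuous and is either 0 or at least 1, so it cannot pass from one regime to the other.

    Since [analytic] means pointwise complex differentiability, the continuity of [phi'] that both
    arguments use must itself be derived, from Cauchy estimates. *)

Section ComplexModulus.
Context {R : realType}.
Implicit Types (z w : Cplx R) (x y : R).

Definition re z : R := complex.Re (z : R[i]).
Definition im z : R := complex.Im (z : R[i]).
Definition conj z : Cplx R := conjc (z : R[i]).
Definition cr x : Cplx R := (x%:C)%C.

Lemma normE z : `|z| = cr (cabs z). Proof. by []. Qed.

Lemma xy_to_C_reim z : xy_to_C (re z, im z) = z. Proof. by case: z. Qed.

Lemma ltr_cr x y : (cr x < cr y) = (x < y). Proof. exact: ltcR. Qed.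
Lemma ler_cr x y : (cr x <= cr y) = (x <= y). Proof. exact: lecR. Qed.
Lemma cr0 : cr 0 = 0. Proof. by []. Qed.
Lemma cr1 : cr 1 = 1. Proof. by []. Qed.

Lemma cabs_ge0 z : 0 <= cabs z.
Proof. by rewrite -ler_cr -normE normr_ge0. Qed.

Lemma cabs0 : cabs (0 : Cplx R) = 0. Proof. exact: Normc.normc0. Qed.
Lemma cabs1 : cabs (1 : Cplx R) = 1. Proof. exact: Normc.normc1. Qed.
Lemma cabsM z w : cabs (z * w) = cabs z * cabs w. Proof. exact: Normc.normcM. Qed.
Lemma cabsD z w : cabs (z + w) <= cabs z + cabs w. Proof. exact: le_normcD. Qed.
Lemma cabsN z : cabs (- z) = cabs z. Proof. exact: normcN. Qed.
Lemma cabsV z : cabs z^-1 = (cabs z)^-1. Proof. exact: Normc.normcV. Qed.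
Lemma cabsX z n : cabs (z ^+ n) = cabs z ^+ n.
Proof. by elim: n => [|n IH]; rewrite ?expr0 ?cabs1// !exprS cabsM IH. Qed.
Lemma cabsC z w : cabs (z - w) = cabs (w - z).
Proof. by rewrite -cabsN opprB. Qed.
Lemma cabs_cr x : cabs (cr x) = `|x|.
Proof. by rewrite /cabs /cr /= expr0n/= addr0 sqrtr_sqr. Qed.
Lemma cabs_nat n : cabs (n%:R : Cplx R) = n%:R.
Proof.
have -> : (n%:R : Cplx R) = cr n%:R by rewrite /cr rmorph_nat.
by rewrite cabs_cr ger0_norm.
Qed.

Lemma cabs_eq0 z : (cabs z == 0) = (z == 0).
Proof.
by apply/eqP/eqP => [/Normc.eq0_normc//|->]; exact: cabs0.
Qed.
Lemma cabs_gt0 z : (0 < cabs z) = (z != 0).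
Proof. by rewrite lt_neqAle cabs_ge0 andbT eq_sym cabs_eq0. Qed.

Lemma cabs_sqr z : cabs z ^+ 2 = re z ^+ 2 + im z ^+ 2.
Proof. by case: z => a b; rewrite /cabs /= sqr_sqrtr// addr_ge0// sqr_ge0. Qed.

Lemma reD z w : re (z + w) = re z + re w. Proof. by case: z; case: w. Qed.
Lemma imD z w : im (z + w) = im z + im w. Proof. by case: z; case: w. Qed.
Lemma reN z : re (- z) = - re z. Proof. by case: z. Qed.
Lemma imN z : im (- z) = - im z. Proof. by case: z. Qed.
Lemma reB z w : re (z - w) = re z - re w. Proof. by rewrite reD reN. Qed.
Lemma imB z w : im (z - w) = im z - im w. Proof. by rewrite imD imN. Qed.
Lemma reM z w : re (z * w) = re z * re w - im z * im w.
Proof. by case: z; case: w. Qed.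
Lemma imM z w : im (z * w) = re z * im w + im z * re w.
Proof. by case: z; case: w. Qed.
Lemma re_cr x : re (cr x) = x. Proof. by []. Qed.
Lemma im_cr x : im (cr x) = 0. Proof. by []. Qed.

Lemma re_inj z w : re z = re w -> im z = im w -> z = w.
Proof. by case: z => a b; case: w => c d /= -> ->. Qed.

Lemma re_le z : `|re z| <= cabs z.
Proof.
rewrite -[leLHS]ger0_norm// -ler_sqr ?nnegrE ?cabs_ge0 ?normr_ge0// cabs_sqr.
by rewrite ger0_norm// real_normK ?num_real// lerDl sqr_ge0.
Qed.

Lemma im_le z : `|im z| <= cabs z.
Proof.
rewrite -[leLHS]ger0_norm// -ler_sqr ?nnegrE ?cabs_ge0 ?normr_ge0// cabs_sqr.
by rewrite ger0_norm// real_normK ?num_real// lerDr sqr_ge0.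
Qed.

Lemma cabs_le z : cabs z <= `|re z| + `|im z|.
Proof.
rewrite -ler_sqr ?nnegrE ?cabs_ge0 ?addr_ge0// cabs_sqr sqrrD.
rewrite !real_normK ?num_real//.
have : 0 <= `|re z| * `|im z| by rewrite mulr_ge0.
by rewrite -mulr_natl; lra.
Qed.

Lemma ler_cabs_dist z w : `|cabs z - cabs w| <= cabs (z - w).
Proof.
rewrite ler_norml; apply/andP; split.
  have := cabsD z (w - z); rewrite (cabsC z w) addrCA subrr addr0; lra.
by have := cabsD (z - w) w; rewrite subrK; lra.
Qed.

Lemma conjM z : conj z * z = cr (cabs z ^+ 2).
Proof.
rewrite cabs_sqr; case: z => a b; apply: re_inj; rewrite ?reM ?imM /re /im/=; ring.
Qed.

Lemma cabs_conj z : cabs (conj z) = cabs z.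
Proof. by case: z => a b; rewrite /cabs /= sqrrN. Qed.

End ComplexModulus.

Section ComplexDerivative.
Context {R : realType}.
Implicit Types (z w l : Cplx R) (f g : Cplx R -> Cplx R).

(** Linear approximation with real tolerances: the point [w = z] needs no exception, and all
    estimates stay in [R] instead of the partially ordered [R[i]]. *)
Definition cdiff f z l := forall e : R, 0 < e -> exists2 d : R, 0 < d &
  forall w, cabs (w - z) < d ->
    cabs (f w - f z - l * (w - z)) <= e * cabs (w - z).

Definition ccont f z := forall e : R, 0 < e -> exists2 d : R, 0 < d &
  forall w, cabs (w - z) < d -> cabs (f w - f z) < e.

Lemma cdiffP f z l : cdiff f z l <-> is_derive z 1 f l.
Proof.
have key : cdiff f z l <-> h^-1 *: (f (h *: 1 + z) - f z) @[h --> 0^'] --> l.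
  split.
    move=> fl; apply/cvgrPdist_le => e e0.
    (* In the order of [R[i]], [0 < e] forces the imaginary part to vanish, so every tolerance is
       the image of a positive real. *)
    have [r r0 er] : exists2 r, 0 < r & e = cr r.
      move: e0; case: e => a b; rewrite ltcE /= => /andP[/eqP -> a0].
      by exists a.
    have [d d0 H] := fl _ r0; rewrite /= in e0 *.
    exists (cr d); first by rewrite /= ltr_cr.
    move=> h /=; rewrite sub0r normrN normE ltr_cr => hd h0.
    rewrite normE er ler_cr.
    have := H (h + z); rewrite addrK => /(_ hd).
    rewrite [h *: 1]mulr1 => K.
    rewrite cabsC -[_ *: _]/(h^-1 * _).
    have -> : h^-1 * (f (h + z) - f z) - l = h^-1 * (f (h + z) - f z - l * h).
      by field.
    rewrite cabsM cabsV mulrC ler_pdivrMr ?cabs_gt0//.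
  move=> /cvgrPdist_le H e e0.
  have := H (cr e); rewrite ltr_cr => /(_ e0)[d /= d0 K].
  have [r r0 dr] : exists2 r, 0 < r & d = cr r.
    move: d0; case: d {K} => a b; rewrite ltcE /= => /andP[/eqP -> a0].
    by exists a.
  exists r => // w wr.
  have [->|wz] := eqVneq w z; first by rewrite !subrr mulr0 subrr cabs0 mulr0.
  have := K (w - z); rewrite /= sub0r normrN normE dr ltr_cr => /(_ wr).
  rewrite subr_eq0 => /(_ wz); rewrite [_ *: 1]mulr1 subrK normE ler_cr.
  have wz0 : w - z != 0 by rewrite subr_eq0.
  rewrite -[_ *: _]/((w - z)^-1 * (f w - f z)) [in X in X -> _]cabsC.
  have -> : (w - z)^-1 * (f w - f z) - l = (w - z)^-1 * (f w - f z - l * (w - z)).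
    by field.
  by rewrite cabsM cabsV mulrC ler_pdivrMr ?cabs_gt0.
split.
  move=> /key H; apply: DeriveDef; first by apply/cvg_ex; exists l.
  by apply: cvg_lim.
by case=> df fl; apply: key.2; rewrite -fl; exact: df.
Qed.

Lemma derivable_cdiff f z : derivable f z 1 -> cdiff f z (derive1 f z).
Proof. by move=> /derivableP; rewrite -derive1E => /cdiffP. Qed.

Lemma cdiff_derive1 f z l : cdiff f z l -> derivable f z 1 /\ derive1 f z = l.
Proof. by move=> /cdiffP H; split; [case: H|rewrite derive1E derive_val]. Qed.

Lemma cdiff_lip f z l : cdiff f z l -> exists2 d : R, 0 < d &
  forall w, cabs (w - z) < d -> cabs (f w - f z) <= (cabs l + 1) * cabs (w - z).
Proof.
move=> /(_ 1 ltr01) [d d0 H]; exists d => // w /H {}H.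
have := cabsD (f w - f z - l * (w - z)) (l * (w - z)).
by rewrite subrK cabsM; lra.
Qed.

Lemma cdiff_cont f z l : cdiff f z l -> ccont f z.
Proof.
move=> /cdiff_lip[d d0 H] e e0.
have l0 : 0 < cabs l + 1 by rewrite ltr_wpDl// cabs_ge0.
exists (Num.min d (e / (cabs l + 1))); first by rewrite lt_min d0 divr_gt0.
move=> w; rewrite lt_min ltr_pdivlMr// => /andP[/H wd we].
by rewrite (le_lt_trans wd)// mulrC.
Qed.

Lemma cdiff_comp f g z l k : cdiff f z l -> cdiff g (f z) k ->
  cdiff (g \o f) z (k * l).
Proof.
move=> fl gk e e0.
have [d1 d10 H1] := cdiff_lip fl.
have l0 : 0 < cabs l + 1 by rewrite ltr_wpDl// cabs_ge0.
have k0 : 0 < cabs k + 1 by rewrite ltr_wpDl// cabs_ge0.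
have e20 : 0 < e / 2 by rewrite divr_gt0.
have [d2 d20 H2] := gk (e / 2 / (cabs l + 1)) (divr_gt0 e20 l0).
have [d3 d30 H3] := fl (e / 2 / (cabs k + 1)) (divr_gt0 e20 k0).
have [d4 d40 H4] := cdiff_cont fl d20.
exists (Num.min d1 (Num.min d3 d4)); first by rewrite !lt_min d10 d30.
move=> w; rewrite !lt_min => /and3P[/H1 {}H1 /H3 {}H3 /H4 /H2 {}H2] /=.
have -> : g (f w) - g (f z) - k * l * (w - z) =
  (g (f w) - g (f z) - k * (f w - f z)) + k * (f w - f z - l * (w - z)) by ring.
apply: le_trans (cabsD _ _) _; rewrite cabsM.
have A : cabs (g (f w) - g (f z) - k * (f w - f z)) <= e / 2 * cabs (w - z).
  apply: le_trans H2 _; rewrite -mulrA ler_wpM2l ?(ltW e20)//.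
  by rewrite ler_pdivrMl.
have B : cabs k * cabs (f w - f z - l * (w - z)) <= e / 2 * cabs (w - z).
  apply: (@le_trans _ _ ((cabs k + 1) * cabs (f w - f z - l * (w - z)))).
    by rewrite ler_wpM2r ?cabs_ge0// lerDl.
  apply: le_trans (ler_wpM2l (ltW k0) H3) _.
  have -> : (cabs k + 1) * (e / 2 / (cabs k + 1) * cabs (w - z)) =
     e / 2 * cabs (w - z) by field; rewrite gt_eqF.
  by [].
lra.
Qed.

End ComplexDerivative.

(** * Integrals on intervals and rectangles *)

Section IntervalIntegral.
Context {R : realType}.
Notation leb := (@lebesgue_measure R).
Implicit Types (h k : R -> R) (a b c : R).

Definition intg a b h : R := \int[leb]_(x in `[a, b]) h x.

Lemma continuous_integrable a b h : continuous h ->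
  leb.-integrable `[a, b] (EFin \o h).
Proof.
move=> ch; apply: continuous_compact_integrable; first exact: segment_compact.
exact: continuous_subspaceT.
Qed.

Lemma intg_split a b c h : a <= b -> b <= c -> continuous h ->
  intg a c h = intg a b h + intg b c h.
Proof.
move=> ab bc ch; rewrite /intg -(@Rintegral_itv_obnd_cbnd _ b); last first.
  apply: integrableS (continuous_integrable b c ch) => //.
  by apply: subset_itvr; rewrite bnd_simp.
rewrite -(@Rintegral_itvB _ _ (BLeft a) (BRight c) b) ?bnd_simp//.
  by rewrite addrC subrK.
exact: continuous_integrable.
Qed.

Lemma intgB a b h k : continuous h -> continuous k ->
  intg a b (fun x => h x - k x) = intg a b h - intg a b k.
Proof.
by move=> ch ck; rewrite /intg RintegralB//; exact: continuous_integrable.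
Qed.

Lemma intg_cst a b c : a <= b -> intg a b (fun=> c) = c * (b - a).
Proof.
move=> ab; rewrite /intg Rintegral_cst//.
congr (_ * _).
transitivity (fine (if (a%:E < b%:E)%E then b%:E - a%:E else 0)%E).
  by congr fine; exact: lebesgue_measure_itv.
rewrite lte_fin; case: ltP => [//|ba].
by have -> : a = b; [apply/eqP; rewrite eq_le ab ba|rewrite subrr].
Qed.

Lemma le_intg a b h k : continuous h -> continuous k ->
  (forall x, a <= x <= b -> h x <= k x) -> intg a b h <= intg a b k.
Proof.
move=> ch ck hk; apply: le_Rintegral => //; exact: continuous_integrable.
Qed.

Lemma intg_le_cst a b h c : a <= b -> continuous h ->
  (forall x, a <= x <= b -> h x <= c) -> intg a b h <= c * (b - a).
Proof.
move=> ab ch hc; rewrite -intg_cst//; apply: le_intg => // ?; exact: cvg_cst.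
Qed.

Lemma intg_ge_cst a b h c : a <= b -> continuous h ->
  (forall x, a <= x <= b -> c <= h x) -> c * (b - a) <= intg a b h.
Proof.
move=> ab ch hc; rewrite -intg_cst//; apply: le_intg => // ?; exact: cvg_cst.
Qed.

Lemma intg_approx a b h c M : a <= b -> continuous h ->
  (forall x, a <= x <= b -> `|h x - c| <= M) ->
  `|intg a b h - c * (b - a)| <= M * (b - a).
Proof.
move=> ab ch H.
have U : intg a b h <= (c + M) * (b - a).
  by apply: intg_le_cst => // x /H; rewrite ler_distl => /andP[_]; lra.
have L : (c - M) * (b - a) <= intg a b h.
  by apply: intg_ge_cst => // x /H; rewrite ler_distl => /andP[+ _]; lra.
by rewrite ler_distl; apply/andP; split; [move: L|move: U]; lra.
Qed.

(** By continuity [h] stays below [c] by half the gap at [t0] on an interval of positive length.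
    Cutting that interval off at [a] and [b] lets [t0] be an endpoint. *)
Lemma intg_lt_cst a b h c t0 : a < b -> continuous h ->
  (forall x, a <= x <= b -> h x <= c) -> a <= t0 <= b -> h t0 < c ->
  intg a b h < c * (b - a).
Proof.
move=> ab ch hc /andP[at0 t0b] ht0.
pose e := (c - h t0) / 2.
have e0 : 0 < e by rewrite divr_gt0// subr_gt0.
have /cvgrPdist_lt /(_ _ e0) := ch t0; move=> /nbhs_ballP[d /= d0 H].
pose l := Num.max a (t0 - d / 2); pose r := Num.min b (t0 + d / 2).
have lr : l < r.
  by rewrite /l /r lt_min !gt_max; apply/andP; split; apply/andP; split; lra.
have al : a <= l by rewrite le_max lexx.
have rb : r <= b by rewrite ge_min lexx.
have lt0 : t0 - d / 2 <= l by rewrite le_max lexx orbT.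
have rt0 : r <= t0 + d / 2 by rewrite ge_min lexx orbT.
have I1 : intg a l h <= c * (l - a).
  apply: intg_le_cst => // x /andP[x1 x2]; apply: hc; lra.
have I2 : intg l r h <= (c - e) * (r - l).
  apply: intg_le_cst => //; first exact: ltW.
  move=> x /andP[x1 x2]; have := H x; rewrite /ball /= ltr_distl => /(_ _)/wrap[].
    by apply/andP; split; lra.
  by rewrite ltr_distl /e => /andP[]; lra.
have I3 : intg r b h <= c * (b - r).
  apply: intg_le_cst => // x /andP[x1 x2]; apply: hc; lra.
rewrite (@intg_split a l b)//; last by rewrite (le_trans (ltW lr)).
rewrite (@intg_split l r b)//; last exact: ltW.
have : 0 < e * (r - l) by rewrite mulr_gt0// subr_gt0.
move: I1 I2 I3; lra.
Qed.

End IntervalIntegral.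

(** * Additive functions of rectangles *)

Section RectangleBisection.
Context {R : realType}.

(* Repeated quartering: some quarter carries at least a quarter of J. *)
Lemma additive_rectangle_eq0 (J : R -> R -> R -> R -> R) (a w b h : R) :
  0 <= w -> 0 <= h ->
  (forall x1 x2 x3 y1 y2, x1 <= x2 -> x2 <= x3 -> y1 <= y2 ->
     J x1 x3 y1 y2 = J x1 x2 y1 y2 + J x2 x3 y1 y2) ->
  (forall x1 x2 y1 y2 y3, x1 <= x2 -> y1 <= y2 -> y2 <= y3 ->
     J x1 x2 y1 y3 = J x1 x2 y1 y2 + J x1 x2 y2 y3) ->
  (forall x y, a <= x <= a + w -> b <= y <= b + h -> forall e, 0 < e ->
     exists2 d, 0 < d & forall x1 x2 y1 y2,
       a <= x1 -> x1 <= x <= x2 -> x2 <= a + w ->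
       b <= y1 -> y1 <= y <= y2 -> y2 <= b + h ->
       x2 - x1 + (y2 - y1) < d ->
       `|J x1 x2 y1 y2| <= e * (x2 - x1 + (y2 - y1)) ^+ 2) ->
  J a (a + w) b (b + h) = 0.
Proof.
move=> w0 h0 Jx Jy Jloc.
apply/eqP; rewrite -normr_eq0; apply/negPn/negP => J0.
set K := `|_| in J0; have {J0} K0 : 0 < K by rewrite lt_def J0 normr_ge0.
have [q [q1 q0 qS qlim]] : exists q : nat -> R, [/\ q 0%N = 1, forall n, 0 < q n,
    forall n, q n = q n.+1 + q n.+1 & forall C d, 0 < C -> 0 < d ->
    exists n, C * q n < d].
  exists (fun n => 2^-1 ^+ n); split => [//|n|n|C d C0 d0].
  - by rewrite exprn_gt0// invr_gt0.
  - by rewrite exprS; lra.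
  have : (fun n => C * 2^-1 ^+ n) @ \oo --> C * 0.
    by apply: cvgMr; apply: cvg_expr; rewrite ger0_norm; lra.
  rewrite mulr0 => /cvgrPdist_lt/(_ _ d0)[n _ /(_ n)] /= H.
  exists n; move: (H (leqnn n)); rewrite sub0r normrN ger0_norm//.
  by rewrite mulr_ge0 ?(ltW C0)// exprn_ge0// invr_ge0.
pose S (p : R * R) n := `|J p.1 (p.1 + w * q n) p.2 (p.2 + h * q n)| >= K * q n ^+ 2.
(* The hypothesis [S p n] sits under the existential, so that a total choice function [g] can be
   extracted and iterated. *)
have step (n : nat) (p : R * R) : exists p' : R * R, S p n -> [/\ S p' n.+1,
     p.1 <= p'.1, p'.1 + w * q n.+1 <= p.1 + w * q n,
     p.2 <= p'.2 & p'.2 + h * q n.+1 <= p.2 + h * q n].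
  case: p => x y; rewrite /S /=.
  have wq : 0 <= w * q n.+1 by rewrite mulr_ge0// ltW.
  have hq : 0 <= h * q n.+1 by rewrite mulr_ge0// ltW.
  pose x' := x + w * q n.+1; pose y' := y + h * q n.+1.
  have xE : x + w * q n = x' + w * q n.+1 by rewrite /x' qS; lra.
  have yE : y + h * q n = y' + h * q n.+1 by rewrite /y' qS; lra.
  rewrite xE yE.
  have xx' : x <= x' by rewrite lerDl.
  have yy' : y <= y' by rewrite lerDl.
  have xx2 : x' <= x' + w * q n.+1 by rewrite lerDl.
  have yy2 : y' <= y' + h * q n.+1 by rewrite lerDl.
  rewrite (Jx _ _ _ _ _ xx' xx2 (le_trans yy' yy2)).
  rewrite (Jy _ _ _ _ _ xx' yy' yy2) (Jy _ _ _ _ _ xx2 yy' yy2).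
  have K4 : K * q n ^+ 2 = 4 * (K * q n.+1 ^+ 2) by rewrite qS; lra.
  rewrite K4.
  have T (u1 u2 u3 u4 M : R) : 4 * M <= `|u1 + u2 + (u3 + u4)| ->
     [\/ M <= `|u1|, M <= `|u2|, M <= `|u3| | M <= `|u4| ].
    move=> H; case: (leP M `|u1|) => H1; first by constructor 1.
    case: (leP M `|u2|) => H2; first by constructor 2.
    case: (leP M `|u3|) => H3; first by constructor 3.
    case: (leP M `|u4|) => H4; first by constructor 4.
    have := ler_normD (u1 + u2) (u3 + u4).
    have := ler_normD u1 u2; have := ler_normD u3 u4; lra.
  case: (pselect (4 * (K * q n.+1 ^+ 2) <= `|J x x' y y' + J x x' y' (y' + h * q n.+1) +
    (J x' (x' + w * q n.+1) y y' + J x' (x' + w * q n.+1) y' (y' + h * q n.+1))|)); last first.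
    by move=> H; exists (x, y) => /H.
  by move=> /T[] H; [exists (x, y)|exists (x, y')|exists (x', y)|exists (x', y')] => _;
    split => //=; rewrite /x' /y'; lra.
have [g Hg] : exists g : nat -> R * R -> R * R, forall n p, S p n -> [/\ S (g n p) n.+1,
     p.1 <= (g n p).1, (g n p).1 + w * q n.+1 <= p.1 + w * q n,
     p.2 <= (g n p).2 & (g n p).2 + h * q n.+1 <= p.2 + h * q n].
  exists (fun n p => sval (cid (step n p))) => n p.
  exact: (svalP (cid (step n p))).
pose u := fix u n := if n is m.+1 then g m (u m) else (a, b).
have Su n : S (u n) n.
  elim: n => [|n IH]; first by rewrite /S /= q1 expr1n !mulr1 lexx.
  by have [] := Hg n _ IH.
have up1 : {homo (fun n => (u n).1) : m n / (m <= n)%N >-> m <= n}.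
  by apply: homo_leq => [//|? ? ?|n]; [exact: le_trans|have [] := Hg n _ (Su n)].
have up2 : {homo (fun n => (u n).2) : m n / (m <= n)%N >-> m <= n}.
  by apply: homo_leq => [//|? ? ?|n]; [exact: le_trans|have [] := Hg n _ (Su n)].
have dn1 : {homo (fun n => (u n).1 + w * q n) : m n / (m <= n)%N >-> n <= m}.
  apply: homo_leq => [//|x y z yx zy|n]; first exact: le_trans zy yx.
  by have [] := Hg n _ (Su n).
have dn2 : {homo (fun n => (u n).2 + h * q n) : m n / (m <= n)%N >-> n <= m}.
  apply: homo_leq => [//|x y z yx zy|n]; first exact: le_trans zy yx.
  by have [] := Hg n _ (Su n).
(* Nested intervals: the supremum of the left ends lies in all of them. Applied to each coordinate,
   it gives the point where the local estimate is used. *)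
have bet (v : nat -> R) (s : R) : 0 <= s ->
    {homo v : m n / (m <= n)%N >-> m <= n} ->
    {homo (fun n => v n + s * q n) : m n / (m <= n)%N >-> n <= m} ->
    exists x, forall n, v n <= x <= v n + s * q n.
  move=> s0 vu vd; exists (sup (range v)) => n.
  have ub m : v m <= v n + s * q n.
    apply: (@le_trans _ _ (v (maxn m n))); first by rewrite vu// leq_maxl.
    apply: (@le_trans _ _ (v (maxn m n) + s * q (maxn m n))).
      by rewrite lerDl mulr_ge0// ltW.
    exact/vd/leq_maxr.
  apply/andP; split.
    apply: ub_le_sup; last by exists n.
    by exists (v n + s * q n) => _ [m _ <-].
  by apply: ge_sup; [exists (v 0%N), 0%N|move=> _ [m _ <-]].
have [x Hx] := bet _ _ w0 up1 dn1.
have [y Hy] := bet _ _ h0 up2 dn2.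
have wh : 0 < w + h + 1 by lra.
have xa : a <= x <= a + w.
  by have := Hx 0%N; rewrite /= q1 !mulr1.
have yb : b <= y <= b + h.
  by have := Hy 0%N; rewrite /= q1 !mulr1.
(* With this tolerance the local bound is at most half of [K * q n ^+ 2], contradicting [S]. The
   [+ 1] keeps the denominator positive for a degenerate rectangle. *)
have e0 : 0 < K / 2 / (w + h + 1) ^+ 2 by rewrite !divr_gt0// exprn_gt0.
have [d d0 Hd] := Jloc x y xa yb _ e0.
have [n nd] := qlim _ _ wh d0.
have /andP[x1 x2] := Hx n; have /andP[y1 y2] := Hy n.
have B1 : a <= (u n).1 by have := up1 0%N n (leq0n n).
have B2 : b <= (u n).2 by have := up2 0%N n (leq0n n).
have B3 : (u n).1 + w * q n <= a + w.
  by have := dn1 0%N n (leq0n n); rewrite /= q1 !mulr1.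
have B4 : (u n).2 + h * q n <= b + h.
  by have := dn2 0%N n (leq0n n); rewrite /= q1 !mulr1.
have sE : (u n).1 + w * q n - (u n).1 + ((u n).2 + h * q n - (u n).2) = (w + h) * q n.
  by ring.
have := Hd _ _ _ _ B1 (Hx n) B3 B2 (Hy n) B4; rewrite sE => /(_ _)/wrap[].
  by apply: le_lt_trans nd; rewrite ler_wpM2r ?(ltW (q0 n))// lerDl.
apply/negP; rewrite -ltNge; apply: lt_le_trans (Su n).
rewrite exprMn mulrA ltr_pM2r ?exprn_gt0//.
have A : (w + h) ^+ 2 <= (w + h + 1) ^+ 2 by rewrite ler_sqr ?nnegrE ?addr_ge0// lerDl.
have A1 : ((w + h + 1) ^+ 2)^-1 * (w + h) ^+ 2 <= 1.
  by rewrite mulrC ler_pdivrMr ?exprn_gt0// mul1r.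
have := ler_wpM2l (ltW K0) A1; lra.
Qed.

End RectangleBisection.

(** * Goursat's lemma and polar coordinates *)

Section Goursat.
Context {R : realType}.
Implicit Types (P Q : R -> R -> R).

(** The integral of [P dx + Q dy] along the boundary of the rectangle, counterclockwise. *)
Definition circulation P Q x1 x2 y1 y2 : R :=
  intg x1 x2 (P ^~ y1) - intg x1 x2 (P ^~ y2) +
  (intg y1 y2 (Q x2) - intg y1 y2 (Q x1)).

Lemma itv_dist (x1 x x2 x' : R) : x1 <= x <= x2 -> x1 <= x' <= x2 ->
  `|x' - x| <= x2 - x1.
Proof.
by move=> /andP[? ?] /andP[? ?]; rewrite ler_norml; apply/andP; split; lra.
Qed.

Lemma error_sub (a b c u v E : R) : `|a - c - u| <= E -> `|b - c - v| <= E ->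
  `|a - b - (u - v)| <= E + E.
Proof.
move=> H1 H2; have -> : a - b - (u - v) = (a - c - u) - (b - c - v) by ring.
by apply: le_trans (ler_normB _ _) _; exact: lerD.
Qed.

Lemma error_add (a b u v E F : R) : `|a - u| <= E -> `|b - v| <= F ->
  u + v = 0 -> `|a + b| <= E + F.
Proof.
move=> H1 H2 uv; have -> : a + b = (a - u) + (b - v) by rewrite addrACA -opprD uv subr0.
by apply: le_trans (ler_normD _ _) _; exact: lerD.
Qed.

(* Goursat's lemma for a closed real 1-form [P dx + Q dy]: the coefficients are
   differentiable with [dP/dy = dQ/dx], but nothing is assumed about the
   continuity of the derivatives. *)
Lemma goursat P Q (a w b h : R) : 0 <= w -> 0 <= h ->
  (forall y, continuous (P ^~ y)) -> (forall x, continuous (Q x)) ->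
  (forall x y, a <= x <= a + w -> b <= y <= b + h ->
     exists A B D, forall e : R, 0 < e -> exists2 d : R, 0 < d & forall x' y',
       a <= x' <= a + w -> b <= y' <= b + h ->
       `|x' - x| + `|y' - y| < d ->
       `|P x' y' - P x y - (A * (x' - x) + B * (y' - y))|
          <= e * (`|x' - x| + `|y' - y|) /\
       `|Q x' y' - Q x y - (B * (x' - x) + D * (y' - y))|
          <= e * (`|x' - x| + `|y' - y|)) ->
  circulation P Q a (a + w) b (b + h) = 0.
Proof.
move=> w0 h0 cP cQ loc; apply: additive_rectangle_eq0 => //.
- move=> x1 x2 x3 y1 y2 x12 x23 y12; rewrite /circulation.
  by rewrite !(intg_split x12 x23)//; ring.
- move=> x1 x2 y1 y2 y3 x12 y12 y23; rewrite /circulation.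
  by rewrite !(intg_split y12 y23)//; ring.
move=> x y xw yh e e0; have [A [B [D H]]] := loc x y xw yh.
have e40 : 0 < e / 4 by rewrite divr_gt0.
have e4 : e / 4 + e / 4 = e / 2 by field.
have [d d0 {}H] := H _ e40; exists d => // x1 x2 y1 y2 ax1 /andP[x1x xx2] x2w
  by1 /andP[y1y yy2] y2h.
set S := x2 - x1 + (y2 - y1) => Sd.
have x12 : x1 <= x2 := le_trans x1x xx2.
have y12 : y1 <= y2 := le_trans y1y yy2.
have S0 : 0 <= S by rewrite addr_ge0 ?subr_ge0.
have near x' y' : x1 <= x' <= x2 -> y1 <= y' <= y2 ->
   `|x' - x| + `|y' - y| <= S.
  by move=> hx hy; apply: lerD; apply: itv_dist; rewrite ?x1x ?y1y.
have bd x' y' : x1 <= x' <= x2 -> y1 <= y' <= y2 ->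
   `|P x' y' - P x y - (A * (x' - x) + B * (y' - y))| <= e / 4 * S /\
   `|Q x' y' - Q x y - (B * (x' - x) + D * (y' - y))| <= e / 4 * S.
  move=> hx hy; have N := near _ _ hx hy.
  have [|||H1 H2] := H x' y'.
  - by case/andP: hx => h1 h2; rewrite (le_trans ax1 h1) (le_trans h2 x2w).
  - by case/andP: hy => h1 h2; rewrite (le_trans by1 h1) (le_trans h2 y2h).
  - by apply: le_lt_trans Sd.
  split; [apply: le_trans H1 _|apply: le_trans H2 _];
    by rewrite ler_wpM2l ?(ltW e40).
have y1i : y1 <= y1 <= y2 by rewrite lexx.
have y2i : y1 <= y2 <= y2 by rewrite lexx y12.
have x1i : x1 <= x1 <= x2 by rewrite lexx.
have x2i : x1 <= x2 <= x2 by rewrite lexx x12.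
(* Opposite edges are subtracted before estimating, so the [A] terms cancel and only [B] remains. In
   [IQ] the [D] terms cancel likewise, and the two [B] contributions are opposite because [dP/dy]
   and [dQ/dx] share the same [B]. *)
have IP : `|intg x1 x2 (fun x' => P x' y1 - P x' y2) - (B * (y1 - y2)) * (x2 - x1)|
    <= e / 2 * S * (x2 - x1).
  apply: intg_approx => //; first by move=> t; apply: cvgB; exact: cP.
  move=> x' hx; have [H1 _] := bd _ _ hx y1i; have [H2 _] := bd _ _ hx y2i.
  have E : A * (x' - x) + B * (y1 - y) - (A * (x' - x) + B * (y2 - y)) =
    B * (y1 - y2) by ring.
  by have := error_sub H1 H2; rewrite E -mulrDl e4.
have IQ : `|intg y1 y2 (fun y' => Q x2 y' - Q x1 y') - (B * (x2 - x1)) * (y2 - y1)|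
    <= e / 2 * S * (y2 - y1).
  apply: intg_approx => //; first by move=> t; apply: cvgB; exact: cQ.
  move=> y' hy; have [_ H1] := bd _ _ x1i hy; have [_ H2] := bd _ _ x2i hy.
  have E : B * (x2 - x) + D * (y' - y) - (B * (x1 - x) + D * (y' - y)) =
    B * (x2 - x1) by ring.
  by have := error_sub H2 H1; rewrite E -mulrDl e4.
have eS : e / 2 * S * (x2 - x1) + e / 2 * S * (y2 - y1) = e / 2 * S ^+ 2.
  by rewrite /S; ring.
have e2 : e / 2 * S ^+ 2 <= e * S ^+ 2.
  by rewrite ler_wpM2r ?sqr_ge0// ler_piMr ?(ltW e0)// invf_le1// ler1n.
apply: le_trans e2; rewrite -eS /circulation -!intgB//.
by apply: error_add IP IQ _; ring.
Qed.

End Goursat.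

(** * The exponential as logarithmic polar coordinates *)

Section PolarCoordinates.
Context {R : realType}.
Implicit Types (s t : R).

(** The exponential of [s + it]. Rectangles in [(s, t)] become annular sectors, so Goursat on
    rectangles yields statements about circles. *)
Definition expc s t : Cplx R := (expR s * cos t +i* (expR s * sin t))%C.

Lemma cabs_expc s t : cabs (expc s t) = expR s.
Proof.
apply/eqP; rewrite -(@eqrXn2 _ 2) ?cabs_ge0 ?expR_ge0// cabs_sqr; apply/eqP.
by rewrite /re /im /= !exprMn -mulrDr cos2Dsin2 mulr1.
Qed.

Lemma expcD s t s' t' : expc (s + s') (t + t') = expc s t * expc s' t'.
Proof.
by apply: re_inj; rewrite ?reM ?imM /re /im /= expRD ?cosD ?sinD; ring.
Qed.

Lemma expc2pi s : expc s (2 * pi) = expc s 0.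
Proof. by rewrite /expc mulr_natl cos2pi sin2pi cos0 sin0. Qed.

Lemma real_derive_approxP (f : R -> R) (x l : R) : is_derive x 1 f l <->
  forall e : R, 0 < e -> exists2 d : R, 0 < d & forall y, `|y - x| < d ->
    `|f y - f x - l * (y - x)| <= e * `|y - x|.
Proof.
have key : (h^-1 *: (f (h *: 1 + x) - f x) @[h --> 0^'] --> l) <->
  forall e : R, 0 < e -> exists2 d : R, 0 < d & forall y, `|y - x| < d ->
    `|f y - f x - l * (y - x)| <= e * `|y - x|.
  split=> [/cvgrPdist_le H e e0|H].
    have [d /= d0 {}H] := H _ e0; exists d => // y yd.
    have [->|yx] := eqVneq y x; first by rewrite !subrr mulr0 subrr normr0 mulr0.
    have yx0 : y - x != 0 by rewrite subr_eq0.
    have := H (y - x); rewrite /= sub0r normrN => /(_ yd yx0).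
    rewrite [_ *: 1]mulr1 subrK -[_ *: _]/((y - x)^-1 * (f y - f x)) distrC.
    have -> : (y - x)^-1 * (f y - f x) - l =
      (y - x)^-1 * (f y - f x - l * (y - x)) by field.
    by rewrite normrM normfV mulrC ler_pdivrMr ?normr_gt0.
  apply/cvgrPdist_le => e e0; have [d d0 {}H] := H _ e0.
  exists d => // h /=; rewrite sub0r normrN => hd h0.
  have := H (h + x); rewrite addrK => /(_ hd) {}H.
  rewrite [h *: 1]mulr1 -[_ *: _]/(h^-1 * (f (h + x) - f x)) distrC.
  have -> : h^-1 * (f (h + x) - f x) - l = h^-1 * (f (h + x) - f x - l * h).
    by field.
  by rewrite normrM normfV mulrC ler_pdivrMr ?normr_gt0.
split=> [[df fl]|/key H].
  by apply/key; rewrite -fl; exact: df.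
by apply: DeriveDef; [apply/cvg_ex; exists l|exact: cvg_lim].
Qed.

Lemma expc_diff0 (e : R) : 0 < e -> exists2 d : R, 0 < d & forall s t,
  `|s| + `|t| < d ->
  cabs (expc s t - 1 - (s +i* t)%C) <= e * (`|s| + `|t|).
Proof.
move=> e0.
(* The error terms below add up to at most [3 e' |s| + 4 e' |t|], so [e / 8] is enough; [e' <= 1]
   gives [|1 + s| <= 2]. *)
pose e' := Num.min 1 (e / 8).
have e'0 : 0 < e' by rewrite lt_min ltr01 divr_gt0.
have e'1 : e' <= 1 by rewrite ge_min lexx.
have e'e : e' <= e / 8 by rewrite ge_min lexx orbT.
clearbody e'.
have [d1 d10 H1] := (real_derive_approxP _ _ _).1 (is_derive_expR 0) _ e'0.
have [d2 d20 H2] := (real_derive_approxP _ _ _).1 (is_derive_cos 0) _ e'0.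
have [d3 d30 H3] := (real_derive_approxP _ _ _).1 (is_derive_sin 0) _ e'0.
exists (Num.min (Num.min d1 d2) (Num.min d3 e')).
  by rewrite !lt_min d10 d20 d30.
move=> s t; rewrite !lt_min => /andP[/andP[h1 h2] /andP[h3 h4]].
have s0 := normr_ge0 s; have t0 := normr_ge0 t.
have := H1 s; have := H2 t; have := H3 t; rewrite !subr0.
rewrite expR0 cos0 sin0 oppr0 mul1r mul0r subr0 mul1r addr0.
have st : `|s| <= `|s| + `|t| by rewrite lerDl.
have ts : `|t| <= `|s| + `|t| by rewrite lerDr.
move=> /(_ (le_lt_trans ts h3)) {}H3 /(_ (le_lt_trans ts h2)) {}H2.
move=> /(_ (le_lt_trans st h1)) {}H1.
have R1 : re (expc s t - 1 - (s +i* t)%C) =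
    (expR s - 1 - s) * cos t + (1 + s) * (cos t - 1).
  by rewrite !reB /re /=; ring.
have I1 : im (expc s t - 1 - (s +i* t)%C) =
    (expR s - 1 - s) * sin t + (1 + s) * (sin t - t) + s * t.
  by rewrite !imB /im /=; ring.
apply: le_trans (cabs_le _) _; rewrite R1 I1.
have c1 : `|cos t| <= 1 by rewrite ler_norml cos_geN1 cos_le1.
have s1 : `|sin t| <= 1 by rewrite ler_norml sin_geN1 sin_le1.
have ss : `|1 + s| <= 2 by apply: le_trans (ler_normD _ _) _; rewrite normr1; lra.
have M (x y X Y : R) : `|x| <= X -> `|y| <= Y -> `|x * y| <= X * Y.
  by move=> ? ?; rewrite normrM ler_pM.
have A1 := M _ _ _ _ H1 c1; have A2 := M _ _ _ _ ss H2.
have A3 := M _ _ _ _ H1 s1; have A4 := M _ _ _ _ ss H3.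
have A5 : `|s * t| <= `|s| * e' by rewrite normrM ler_wpM2l// ltW// (le_lt_trans ts h4).
have B1 := ler_normD ((expR s - 1 - s) * cos t) ((1 + s) * (cos t - 1)).
have B2 := ler_normD ((expR s - 1 - s) * sin t + (1 + s) * (sin t - t)) (s * t).
have B3 := ler_normD ((expR s - 1 - s) * sin t) ((1 + s) * (sin t - t)).
have C1 : e' * `|s| <= e / 8 * `|s| by rewrite ler_wpM2r.
have C2 : e' * `|t| <= e / 8 * `|t| by rewrite ler_wpM2r.
have C3 : 0 <= e * `|s| by rewrite mulr_ge0// ltW.
have C4 : 0 <= e * `|t| by rewrite mulr_ge0// ltW.
lra.
Qed.

(** The addition law moves the estimate at the origin to [(s, t)]; the factor [expc s t] has modulus
    [expR s], hence the tolerance [e / expR s]. *)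
Lemma expc_diff s t (e : R) : 0 < e -> exists2 d : R, 0 < d & forall s' t',
  `|s' - s| + `|t' - t| < d ->
  cabs (expc s' t' - expc s t - expc s t * ((s' - s) +i* (t' - t))%C)
    <= e * (`|s' - s| + `|t' - t|).
Proof.
move=> e0; have [d d0 H] := expc_diff0 (divr_gt0 e0 (expR_gt0 s)).
exists d => // s' t' /H {}H.
have -> : expc s' t' - expc s t - expc s t * ((s' - s) +i* (t' - t))%C =
   expc s t * (expc (s' - s) (t' - t) - 1 - ((s' - s) +i* (t' - t))%C).
  rewrite 2!mulrBr mulr1 -expcD.
  by rewrite (addrC s) (addrC t) !subrK.
rewrite cabsM cabs_expc mulrC -ler_pdivlMr ?expR_gt0//.
by apply: le_trans H _; rewrite mulrAC.
Qed.

End PolarCoordinates.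

(** * Mean value property and Cauchy estimates *)

Section MeanValue.
Context {R : realType}.
Implicit Types (f : Cplx R -> Cplx R) (c z w l : Cplx R) (s t r : R).

(** The chain rule in real variables. That the differential is multiplication by one complex number
    [L] is the Cauchy-Riemann system, which provides the closed form for Goursat. *)
Lemma polar_diff f c l s t : cdiff f (c + expc s t) l ->
  exists L : Cplx R, forall e : R, 0 < e -> exists2 d : R, 0 < d & forall s' t',
  `|s' - s| + `|t' - t| < d ->
  cabs (f (c + expc s' t') - f (c + expc s t) - L * ((s' - s) +i* (t' - t))%C)
    <= e * (`|s' - s| + `|t' - t|).
Proof.
move=> fl; exists (l * expc s t) => e e0.
have E0 := expR_gt0 s.
have l0 : 0 < cabs l + 1 by rewrite ltr_wpDl// cabs_ge0.
have e20 : 0 < e / 2 by rewrite divr_gt0.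
have E20 : 0 < expR s + 1 by lra.
have [d1 d10 H1] := fl _ (divr_gt0 e20 E20).
have [d2 d20 H2] := expc_diff s t (divr_gt0 e20 l0).
have [d3 d30 H3] := expc_diff s t (@ltr01 R).
exists (Num.min d2 (Num.min d3 (d1 / (expR s + 1)))).
  by rewrite !lt_min d20 d30 divr_gt0.
move=> s' t'; set S := `|_| + `|_|; rewrite !lt_min => /and3P[/H2 {}H2 /H3 {}H3].
rewrite ltr_pdivlMr// => SE.
set D := ((s' - s) +i* (t' - t))%C in H2 H3 *.
have DS : cabs D <= S by exact: cabs_le.
have S0 : 0 <= S by rewrite addr_ge0.
have K : cabs (expc s' t' - expc s t) <= (expR s + 1) * S.
  have := cabsD (expc s' t' - expc s t - expc s t * D) (expc s t * D).
  rewrite subrK cabsM cabs_expc.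
  have := ler_wpM2l (ltW E0) DS; move: H3; rewrite mul1r -/S; lra.
have := H1 (c + expc s' t').
have -> : c + expc s' t' - (c + expc s t) = expc s' t' - expc s t by ring.
move=> /(_ (le_lt_trans K _))/wrap[]; first by rewrite mulrC.
set N := f (c + expc s' t') - f (c + expc s t) => {}H1.
have -> : N - l * expc s t * D = (N - l * (expc s' t' - expc s t)) +
   l * (expc s' t' - expc s t - expc s t * D) by ring.
apply: le_trans (cabsD _ _) _; rewrite cabsM.
have A : cabs (N - l * (expc s' t' - expc s t)) <= e / 2 * S.
  apply: le_trans H1 _.
  have A0 : cabs (expc s' t' - expc s t) / (expR s + 1) <= S.
    by rewrite ler_pdivrMr// mulrC.
  apply: le_trans (ler_wpM2l (ltW e20) A0).
  by rewrite mulrAC mulrA.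
have B : cabs l * cabs (expc s' t' - expc s t - expc s t * D) <= e / 2 * S.
  have lT : cabs l <= cabs l + 1 by lra.
  apply: le_trans (ler_pM (cabs_ge0 _) (cabs_ge0 _) lT H2) _.
  have -> x : (cabs l + 1) * (e / 2 / (cabs l + 1) * x) = e / 2 * x.
    by field; rewrite gt_eqF.
  exact: lexx.
lra.
Qed.

Lemma polar_cont f c l s t : cdiff f (c + expc s t) l ->
  forall e : R, 0 < e -> exists2 d : R, 0 < d & forall s' t',
  `|s' - s| + `|t' - t| < d ->
  cabs (f (c + expc s' t') - f (c + expc s t)) < e.
Proof.
move=> /polar_diff[L H] e e0; have [d d0 {}H] := H 1 ltr01.
have L0 : 0 < cabs L + 1 by rewrite ltr_wpDl// cabs_ge0.
exists (Num.min d (e / (cabs L + 1))); first by rewrite lt_min d0 divr_gt0.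
move=> s' t'; rewrite lt_min ltr_pdivlMr// => /andP[/H {}H Se].
set D := ((s' - s) +i* (t' - t))%C in H *.
have DS : cabs D <= `|s' - s| + `|t' - t| by exact: cabs_le.
have := cabsD (f (c + expc s' t') - f (c + expc s t) - L * D) (L * D).
have := ler_wpM2l (cabs_ge0 L) DS.
by rewrite subrK cabsM; lra.
Qed.

Lemma re_sub_lt z w (e : R) : cabs (z - w) < e -> `|re w - re z| < e.
Proof. by rewrite distrC -reB; exact/le_lt_trans/re_le. Qed.

Lemma im_sub_lt z w (e : R) : cabs (z - w) < e -> `|im w - im z| < e.
Proof. by rewrite distrC -imB; exact/le_lt_trans/im_le. Qed.

Lemma circle_cont f c s : (forall z, cabs (z - c) = expR s -> exists l, cdiff f z l) ->
  continuous (fun t => re (f (c + expc s t))).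
Proof.
move=> df t; apply/cvgrPdist_lt => e e0.
have [|l fl] := df (c + expc s t); first by rewrite (addrC c) addrK cabs_expc.
have [d d0 H] := polar_cont fl e0; exists d => //= t' tt'; apply: re_sub_lt.
by apply: H; rewrite subrr normr0 add0r distrC.
Qed.

(** With [F(s, t) = f (c + expc s t)], the form [im F ds + re F dt] is closed. Its integrals along
    [t = 0] and [t = 2 pi] agree by periodicity, so the circle average does not depend on the
    radius, and continuity at [c] gives its value as the radius shrinks. The centre is left out of
    the differentiability hypothesis so that difference quotients are covered. *)
Lemma mean_value f c (rho s : R) :
  (forall z, 0 < cabs (z - c) < rho -> exists l, cdiff f z l) ->
  ccont f c -> expR s < rho ->
  intg 0 (2 * pi) (fun t => re (f (c + expc s t))) = re (f c) * (2 * pi).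
Proof.
move=> df cf srho.
have dfE x t : x <= s -> exists l, cdiff f (c + expc x t) l.
  move=> xs; apply: df; rewrite (addrC c) addrK cabs_expc expR_gt0 /=.
  by apply: le_lt_trans srho; rewrite ler_expR.
have pi20 : 0 <= 2 * pi :> R by rewrite mulr_ge0// pi_ge0.
(* Capping the logarithmic radius at [s] makes the coefficients continuous on whole lines, as
   [goursat] asks, without changing them on the rectangle. *)
have cQ x : continuous (fun t => re (f (c + expc (Num.min x s) t))).
  apply: circle_cont => z zc; apply: df; rewrite zc expR_gt0/=.
  by apply: le_lt_trans srho; rewrite ler_expR ge_min lexx orbT.
have cP t : continuous (fun x => im (f (c + expc (Num.min x s) t))).
  move=> x; apply/cvgrPdist_lt => e e0.
  have [|l fl] := dfE (Num.min x s) t; first by rewrite ge_min lexx orbT.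
  have [d d0 H] := polar_cont fl e0; exists d => //= x' xx'; apply: im_sub_lt.
  apply: H; rewrite subrr normr0 addr0; apply: le_lt_trans xx'.
  rewrite distrC; case: (leP x s) => h1; case: (leP x' s) => h2 //.
  - by rewrite !ler0_norm; lra.
  - by rewrite !ger0_norm; lra.
  - by rewrite subrr normr0.
have const s1 : s1 <= s -> intg 0 (2 * pi) (fun t => re (f (c + expc s t))) =
    intg 0 (2 * pi) (fun t => re (f (c + expc s1 t))).
  move=> s1s.
  have ss1 : 0 <= s - s1 by lra.
  have := @goursat R (fun x t => im (f (c + expc (Num.min x s) t)))
    (fun x t => re (f (c + expc (Num.min x s) t))) s1 (s - s1) 0 (2 * pi) ss1 pi20 cP cQ.
  rewrite add0r subrKC /circulation.
  have -> : (fun x => im (f (c + expc (Num.min x s) 0))) =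
            (fun x => im (f (c + expc (Num.min x s) (2 * pi)))).
    by apply/funext => x; rewrite expc2pi.
  rewrite subrr add0r minxx (min_l s1s) => H.
  apply/eqP; rewrite -subr_eq0; apply/eqP/H => {H} x t /andP[sx xs] _.
  have [l /polar_diff[L HL]] := dfE x t xs.
  (* These are the coefficients of the imaginary and real parts of [L * (ds + i dt)]; [re L] occurs
     in both. *)
  exists (im L), (re L), (- im L) => e e0; have [d d0 {}HL] := HL e e0.
  exists d => // x' t' /andP[_ xs'] _ /HL {}HL.
  rewrite (min_l xs) (min_l xs'); split.
    apply: le_trans HL; apply: le_trans (im_le _); rewrite !imB imM /re /im /=.
    by rewrite le_eqVlt; apply/orP; left; apply/eqP; congr `|_|; ring.
  apply: le_trans HL; apply: le_trans (re_le _); rewrite !reB reM /re /im /=.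
  by rewrite le_eqVlt; apply/orP; left; apply/eqP; congr `|_|; ring.
apply/eqP; rewrite -subr_eq0 -normr_le0; apply/ler_addgt0Pl => e e0.
rewrite addr0.
have pi0 : 0 < 2 * pi :> R by rewrite mulr_gt0// pi_gt0.
have [d d0 H] := cf (e / (2 * pi)) (divr_gt0 e0 pi0).
(* A circle of radius at most [d / 2], on which [f] is within [e / (2 pi)] of [f c]. *)
pose s1 := Num.min s (ln (d / 2)).
have s1s : s1 <= s by rewrite ge_min lexx.
have s1d : expR s1 < d.
  apply: (@le_lt_trans _ _ (expR (ln (d / 2)))).
    by rewrite ler_expR ge_min lexx orbT.
  by rewrite lnK ?posrE ?divr_gt0//; lra.
have cQ1 := cQ s1; rewrite (min_l s1s) in cQ1.
rewrite (const _ s1s) -[X in _ - _ * X]subr0.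
have -> : e = e / (2 * pi) * (2 * pi - 0) by rewrite subr0 divfK// gt_eqF.
apply: intg_approx => // t _; rewrite distrC; apply/ltW/re_sub_lt/H.
by rewrite (addrC c) addrK cabs_expc.
Qed.

Lemma cdiff_near f g z l (d : R) : 0 < d ->
  (forall w, cabs (w - z) < d -> f w = g w) -> cdiff f z l -> cdiff g z l.
Proof.
move=> d0 fg fl e e0; have [d1 d10 H] := fl e e0.
exists (Num.min d d1); first by rewrite lt_min d0.
move=> w; rewrite lt_min => /andP[wd /H].
by rewrite (fg _ wd) (fg z)// subrr cabs0.
Qed.

Lemma cdiff_quotient f z l (a b c : Cplx R) : cdiff f z l -> z != c ->
  exists k, cdiff (fun w => a * (f w - b) / (w - c)) z k.
Proof.
move=> /cdiffP fl zc.
have d1 : derivable (fun w => a * (f w - b)) z 1.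
  apply: derivableM; first exact: derivable_cst.
  by apply: derivableB; [case: fl|exact: derivable_cst].
have d2 : derivable (fun w : Cplx R => (w - c)^-1) z 1.
  apply: derivableV; first by rewrite subr_eq0.
  by apply: derivableB; [exact: derivable_id|exact: derivable_cst].
exists (derive1 (fun w => a * (f w - b) / (w - c)) z).
apply: derivable_cdiff; exact: derivableM d1 d2.
Qed.

(** The difference quotient with its removable singularity filled by [l]. It is continuous at [c]
    when [l] is the derivative, which is all that [mean_value] requires there. *)
Definition slope f c l z := if z == c then l else (f z - f c) / (z - c).

Lemma slope_cdiff f c l (k z l' : Cplx R) : cdiff f z l' -> z != c ->
  exists m, cdiff (fun w => k * slope f c l w) z m.
Proof.
move=> fl zc; have [m Hm] := cdiff_quotient k (f c) fl zc; exists m.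
apply: (@cdiff_near _ _ _ _ (cabs (z - c)) _ _ Hm); first by rewrite cabs_gt0 subr_eq0.
move=> w wz; rewrite /slope; case: eqP => [wc|_]; last by rewrite mulrA.
by move: wz; rewrite wc cabsC ltxx.
Qed.

Lemma slope_ccont f c l k : cdiff f c l -> ccont (fun w => k * slope f c l w) c.
Proof.
move=> fl e e0.
have k0 : 0 < cabs k + 1 by rewrite ltr_wpDl// cabs_ge0.
have [d d0 H] := fl _ (divr_gt0 e0 k0); exists d => // w /H {}H.
rewrite -mulrBr cabsM /slope eqxx; case: eqP => [_|/eqP wc].
  by rewrite subrr cabs0 mulr0.
have wc0 : w - c != 0 by rewrite subr_eq0.
have -> : (f w - f c) / (w - c) - l = (f w - f c - l * (w - c)) / (w - c).
  by field.
rewrite cabsM cabsV.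
have {}H : cabs (f w - f c - l * (w - c)) / cabs (w - c) <= e / (cabs k + 1).
  by rewrite ler_pdivrMr ?cabs_gt0.
apply: le_lt_trans (ler_wpM2l (cabs_ge0 k) H) _.
rewrite mulrCA gtr_pMr// ltr_pdivrMr// mul1r; lra.
Qed.

(** The difference quotient has mean [l] over the circle of radius [r], where its modulus is at most
    [2 * M / r]. Multiplying by [conj l] makes the mean real, so that real parts suffice. *)
Lemma cauchy_estimate f c l (rho M r : R) : cdiff f c l ->
  (forall z, cabs (z - c) < rho -> exists l, cdiff f z l) ->
  (forall z, cabs (z - c) < rho -> cabs (f z) <= M) ->
  0 < r -> r < rho -> cabs l <= 2 * M / r.
Proof.
move=> fl df fM r0 rrho.
have [->|l0] := eqVneq l 0.
  rewrite cabs0 divr_ge0 ?(ltW r0)// mulr_ge0//.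
  by apply: le_trans (cabs_ge0 _) (fM c _); rewrite subrr cabs0 (lt_trans r0).
have rE : expR (ln r) = r by rewrite lnK.
have := @mean_value (fun w => conj l * slope f c l w) c rho (ln r).
move=> /(_ _ (slope_ccont (conj l) fl))/wrap[|].
  move=> z /andP[zc zr]; have [l' fl'] := df z zr.
  by apply: slope_cdiff fl' _; rewrite -subr_eq0 -cabs_gt0.
move=> /(_ _)/wrap[|]; first by rewrite rE.
rewrite {2}/slope eqxx conjM re_cr => I.
have pi0 : 0 < 2 * pi :> R by rewrite mulr_gt0// pi_gt0.
have L0 : 0 < cabs l by rewrite cabs_gt0.
have : cabs l ^+ 2 * (2 * pi - 0) <= cabs l * (2 * M / r) * (2 * pi - 0).
  rewrite subr0 -I -[X in _ <= _ * X]subr0; apply: intg_le_cst; first exact: ltW.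
    apply: (@circle_cont (fun w => conj l * slope f c l w)) => z; rewrite rE => zr.
    have [|l' fl'] := df z; first by rewrite zr.
    by apply: slope_cdiff fl' _; rewrite -subr_eq0 -cabs_gt0 zr.
  move=> t _; apply: le_trans (ler_norm _) _; apply: le_trans (re_le _) _.
  rewrite cabsM cabs_conj ler_wpM2l ?(ltW L0)// /slope.
  have E : c + expc (ln r) t - c = expc (ln r) t by rewrite (addrC c) addrK.
  rewrite -subr_eq0 E -cabs_eq0 cabs_expc rE gt_eqF// cabsM cabsV cabs_expc rE.
  rewrite ler_pM2r ?invr_gt0//; apply: le_trans (cabsD _ _) _; rewrite cabsN.
  have := fM c; rewrite subrr cabs0 => /(_ (lt_trans r0 rrho)).
  by have := fM (c + expc (ln r) t); rewrite E cabs_expc rE => /(_ rrho); lra.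
by rewrite subr0 ler_pM2r// expr2 ler_pM2l.
Qed.

(** The real mean value theorem is applied to the component of [f] in the direction of the increment
    [f z - f w], along the segment from [w] to [z]. *)
Lemma cdiff_lipschitz f z w (L : R) :
  (forall t, 0 <= t <= 1 -> exists2 l, cdiff f (w + cr t * (z - w)) l & cabs l <= L) ->
  cabs (f z - f w) <= L * cabs (z - w).
Proof.
move=> H; set k := conj (f z - f w).
have [->|fzw] := eqVneq (f z - f w) 0.
  rewrite cabs0 mulr_ge0 ?cabs_ge0//.
  by have [|l _] := H 0; [rewrite lexx ler01|apply: le_trans (cabs_ge0 _)].
have D0 : 0 < cabs (f z - f w) by rewrite cabs_gt0.
pose h t := re (k * f (w + cr t * (z - w))).
have [l Hl] : exists l : R -> Cplx R, forall t, 0 <= t <= 1 ->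
   cdiff f (w + cr t * (z - w)) (l t) /\ cabs (l t) <= L.
  have ex t : exists l, 0 <= t <= 1 -> cdiff f (w + cr t * (z - w)) l /\ cabs l <= L.
    case: (pselect (0 <= t <= 1)) => [/H[l ? ?]|]; first by exists l.
    by exists 0.
  by exists (fun t => sval (cid (ex t))) => t; exact: (svalP (cid (ex t))).
have dh t : 0 <= t <= 1 -> is_derive t 1 h (re (k * (l t * (z - w)))).
  move=> /Hl[fl _]; apply/real_derive_approxP => e e0.
  have C0 : 0 < cabs k * cabs (z - w) + 1.
    by rewrite ltr_wpDl// mulr_ge0// cabs_ge0.
  have [d d0 Hd] := fl _ (divr_gt0 e0 C0).
  have W0 : 0 < cabs (z - w) + 1 by rewrite ltr_wpDl// cabs_ge0.
  exists (d / (cabs (z - w) + 1)); first by rewrite divr_gt0.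
  move=> y; rewrite ltr_pdivlMr// => yt.
  have E : w + cr y * (z - w) - (w + cr t * (z - w)) = cr (y - t) * (z - w).
    by rewrite /cr rmorphB /=; ring.
  have := Hd (w + cr y * (z - w)); rewrite E cabsM cabs_cr => /(_ _)/wrap[].
    by apply: le_lt_trans yt; rewrite ler_wpM2l//; lra.
  set N := cabs _ => HN.
  have -> : h y - h t - re (k * (l t * (z - w))) * (y - t) =
    re (k * (f (w + cr y * (z - w)) - f (w + cr t * (z - w)) -
      l t * (cr (y - t) * (z - w)))).
    by rewrite /h !(reM, imM, reB, imB) !re_cr !im_cr; ring.
  apply: le_trans (re_le _) _; rewrite cabsM -/N.
  apply: le_trans (ler_wpM2l (cabs_ge0 _) HN) _.
  have -> : cabs k * (e / (cabs k * cabs (z - w) + 1) * (`|y - t| * cabs (z - w))) =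
   (e * `|y - t|) * (cabs k * cabs (z - w) / (cabs k * cabs (z - w) + 1)) by ring.
  rewrite ler_piMr ?mulr_ge0 ?(ltW e0)// ler_pdivrMr// mul1r; lra.
have [||c /andP[c0 c1] hc] := @MVT_segment R h (fun t => re (k * (l t * (z - w)))) 0 1 ler01.
- by move=> x; rewrite in_itv /= => /andP[x0 x1]; apply: dh; rewrite !ltW.
- apply: derivable_within_continuous => x; rewrite in_itv /= => /dh.
  by case.
have {c0 c1} ci : 0 <= c <= 1 by move: c0 c1; rewrite !bnd_simp => -> ->.
have hE : h 1 - h 0 = cabs (f z - f w) ^+ 2.
  rewrite /h -reB -mulrBr cr1 cr0 mul1r mul0r addr0 subrKC conjM.
  by rewrite re_cr.
have : cabs (f z - f w) ^+ 2 <= cabs (f z - f w) * (L * cabs (z - w)).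
  rewrite -hE hc subr0 mulr1; apply: le_trans (ler_norm _) _.
  apply: le_trans (re_le _) _; rewrite !cabsM cabs_conj ler_wpM2l ?cabs_ge0//.
  by rewrite ler_wpM2r ?cabs_ge0//; case: (Hl c ci).
by rewrite expr2 ler_pM2l.
Qed.

(** The function [f u - f (u + (b - w))] has derivative [derive1 f w - derive1 f b] at [w], and the
    Lipschitz bound makes it of size [L * |w - b|] near [w]. A Cauchy estimate for it therefore
    bounds the variation of the derivative linearly. *)
Lemma derive1_ccont f b (rho : R) : 0 < rho ->
  (forall z, cabs (z - b) < rho -> derivable f z 1) -> ccont (derive1 f) b.
Proof.
move=> rho0 df.
have [d [d0 drho [M fM]]] : exists d : R, [/\ 0 < d, d <= rho &
    exists M : R, forall z, cabs (z - b) < d -> cabs (f z) <= M].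
  have := derivable_cdiff (df b _); rewrite subrr cabs0 => /(_ rho0).
  move=> /cdiff_cont/(_ 1 ltr01)[d d0 H].
  exists (Num.min d rho); split; rewrite ?lt_min ?d0// ?ge_min ?lexx ?orbT//.
  exists (cabs (f b) + 1) => z; rewrite lt_min => /andP[/H {}H _].
  by have := cabsD (f z - f b) (f b); rewrite subrK; lra.
have dfd z : cabs (z - b) < d -> cdiff f z (derive1 f z).
  by move=> zd; apply/derivable_cdiff/df; exact: lt_le_trans drho.
have tri z w y : cabs (z - y) <= cabs (z - w) + cabs (w - y).
  by have := cabsD (z - w) (w - y); rewrite addrA subrK.
(* The Cauchy bound on circles of radius [d / 4] about points within [d / 2] of [b]. *)
pose L := 2 * M / (d / 4).
have L1 z : cabs (z - b) < d / 2 -> cabs (derive1 f z) <= L.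
  move=> zd; apply: (@cauchy_estimate f z _ (d / 2)); rewrite ?divr_gt0//; last lra.
  - by apply: dfd; lra.
  - move=> w wz; exists (derive1 f w); apply: dfd.
    by have := tri w z b; lra.
  - by move=> w wz; apply: fM; have := tri w z b; lra.
have L2 z w : cabs (z - b) < d / 2 -> cabs (w - b) < d / 2 ->
    cabs (f z - f w) <= L * cabs (z - w).
  move=> zd wd; apply: cdiff_lipschitz => t /andP[t0 t1].
  have C : cabs (w + cr t * (z - w) - b) < d / 2.
    have -> : w + cr t * (z - w) - b = cr t * (z - b) + cr (1 - t) * (w - b).
      by rewrite /cr rmorphB /= -/(cr 1) cr1; ring.
    apply: le_lt_trans (cabsD _ _) _; rewrite !cabsM !cabs_cr !ger0_norm; [|lra..].
    have [t12|t12] := leP t (1 / 2).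
      have := ler_wpM2l t0 (ltW zd).
      have : (1 - t) * cabs (w - b) < (1 - t) * (d / 2) by rewrite ltr_pM2l//; lra.
      lra.
    have : t * cabs (z - b) < t * (d / 2) by rewrite ltr_pM2l//; lra.
    have : (1 - t) * cabs (w - b) <= (1 - t) * (d / 2) by rewrite ler_wpM2l//; lra.
    lra.
  exists (derive1 f (w + cr t * (z - w))); last exact: L1.
  by apply: dfd; lra.
have L0 : 0 <= L.
  by apply: le_trans (cabs_ge0 _) (L1 b _); rewrite subrr cabs0 divr_gt0.
have est w : cabs (w - b) < d / 4 ->
    cabs (derive1 f w - derive1 f b) <= 2 * (L * cabs (w - b)) / (d / 8).
  move=> wd.
  have gd z : cabs (z - w) < d / 4 ->
    cdiff (fun u => f u - f (u + (b - w))) z (derive1 f z - derive1 f (z + (b - w))).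
    move=> zw e e0; have e20 : 0 < e / 2 by rewrite divr_gt0.
    have [|d1 d10 H1] := dfd z _ (e / 2) e20; first by have := tri z w b; lra.
    have E1 : z + (b - w) - b = z - w by ring.
    have [|d2 d20 H2] := dfd (z + (b - w)) _ (e / 2) e20; first by rewrite E1; lra.
    exists (Num.min d1 d2); first by rewrite lt_min d10.
    move=> u; rewrite lt_min => /andP[/H1 {}H1 u2].
    have E2 : u + (b - w) - (z + (b - w)) = u - z by ring.
    have := H2 (u + (b - w)); rewrite E2 => /(_ u2) {}H2.
    set A := f u - f z - _ in H1; set B := f _ - f _ - _ in H2.
    have alg (x y x' y' p q h : Cplx R) : x - y - (x' - y') - (p - q) * h =
      (x - x' - p * h) - (y - y' - q * h) by ring.
    rewrite alg -/A -/B.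
    apply: le_trans (cabsD _ _) _; rewrite cabsN.
    by apply: le_trans (lerD H1 H2) _; rewrite -mulrDl -splitr.
  apply: (@cauchy_estimate (fun u => f u - f (u + (b - w))) w _ (d / 4)).
  - have E : w + (b - w) = b by ring.
    by have := gd w; rewrite E subrr cabs0; apply; rewrite divr_gt0.
  - by move=> z /gd H; eexists; exact: H.
  - move=> z zw; have E : z - (z + (b - w)) = w - b by ring.
    rewrite -E; apply: L2; first by have := tri z w b; lra.
    have -> : z + (b - w) - b = z - w by ring.
    lra.
  - by rewrite divr_gt0.
  - lra.
move=> e e0.
have d8 : 0 <= d / 8 by rewrite divr_ge0// ltW.
have K0 : 0 < 2 * L / (d / 8) + 1.
  by rewrite ltr_wpDl// divr_ge0// mulr_ge0.
exists (Num.min (d / 4) (e / (2 * L / (d / 8) + 1))).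
  by rewrite lt_min !divr_gt0.
move=> w; rewrite lt_min => /andP[/est H]; rewrite ltr_pdivlMr// => we.
apply: le_lt_trans H _.
have -> : 2 * (L * cabs (w - b)) / (d / 8) = cabs (w - b) * (2 * L / (d / 8)) by ring.
by have := cabs_ge0 (w - b); lra.
Qed.

End MeanValue.

(** * Schwarz lemma *)

Section Schwarz.
Context {R : realType}.
Implicit Types (f : Cplx R -> Cplx R) (c z w l : Cplx R) (s t r : R).

Definition rcont (g : Cplx R -> R) z := forall e : R, 0 < e ->
  exists2 d : R, 0 < d & forall w, cabs (w - z) < d -> `|g w - g z| < e.

Lemma rcont_continuous (g : Cplx R -> R) (v : R * R) : rcont g (xy_to_C v) ->
  {for v, continuous (g \o @xy_to_C R)}.
Proof.
move=> gv; apply/cvgrPdist_lt => e e0; have [d d0 H] := gv e e0.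
have d20 : 0 < d / 2 by rewrite divr_gt0.
exists (ball v.1 (d / 2), ball v.2 (d / 2)); first by split; exact: nbhsx_ballx.
move=> y [b1 b2]; rewrite distrC; apply: H.
have N : cabs (xy_to_C y - xy_to_C v) <= `|y.1 - v.1| + `|y.2 - v.2| := cabs_le _.
apply: le_lt_trans N _; rewrite (splitr d) distrC (distrC y.2); exact: ltrD.
Qed.

Lemma disk0 : disk (0 : Cplx R).
Proof. by rewrite /disk /mkset cabs0 ltr01. Qed.

Lemma closed_disk_max (g : Cplx R -> R) r : 0 <= r ->
  (forall z, cabs z <= r -> rcont g z) ->
  exists2 z0, cabs z0 <= r & forall z, cabs z <= r -> g z <= g z0.
Proof.
move=> r0 cg.
pose K : set (R * R) := [set v | cabs (xy_to_C v) <= r].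
have cabs_cont : continuous ((@cabs R) \o @xy_to_C R).
  move=> v; apply: rcont_continuous => e e0; exists e => // w.
  exact/le_lt_trans/ler_cabs_dist.
have cK : compact K.
  apply: (@subclosed_compact _ _ (`[- r, r] `*` `[- r, r])).
  - rewrite (_ : K = (cabs \o @xy_to_C R) @^-1` [set x | x <= r])//.
    by apply: closed_comp; [move=> v _; exact: cabs_cont|exact: closed_le].
  - by apply: compact_setX; exact: segment_compact.
  - move=> v vK; split; rewrite /= in_itv /= -ler_norml.
      exact: le_trans (re_le (xy_to_C v)) vK.
    exact: le_trans (im_le (xy_to_C v)) vK.
have [||v vK vmax] := @compact_EVT_max _ R (g \o @xy_to_C R) K _ cK.
- by exists (0, 0); rewrite /K /mkset -[xy_to_C _]/(0 : Cplx R) cabs0.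
- apply: continuous_in_subspaceT => v /set_mem vK.
  exact/rcont_continuous/cg.
exists (xy_to_C v); first by move/set_mem: vK.
move=> z zr; have zK : (re z, im z) \in K.
  by apply/mem_set; rewrite /K /mkset xy_to_C_reim.
by have := vmax _ zK; rewrite /comp xy_to_C_reim.
Qed.

Lemma cdiff_add_linear f z l (a b : Cplx R) : cdiff f z l ->
  cdiff (fun w => f w + a * (w - b)) z (l + a).
Proof.
move=> fl e e0; have [d d0 H] := fl e e0; exists d => // w /H.
have alg (x y u v : Cplx R) : x + a * (u - b) - (y + a * (v - b)) - (l + a) * (u - v) =
  x - y - l * (u - v) by ring.
by rewrite alg.
Qed.

Lemma ccont_add_linear f z (a b : Cplx R) : ccont f z ->
  ccont (fun w => f w + a * (w - b)) z.
Proof.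
move=> fz e e0; have e20 : 0 < e / 2 by rewrite divr_gt0.
have a0 : 0 < cabs a + 1 by rewrite ltr_wpDl// cabs_ge0.
have [d d0 H] := fz _ e20; exists (Num.min d (e / 2 / (cabs a + 1))).
  by rewrite lt_min d0 divr_gt0.
move=> w; rewrite lt_min ltr_pdivlMr// => /andP[/H {}H we].
have alg (x y u v : Cplx R) : x + a * (u - b) - (y + a * (v - b)) =
  x - y + a * (u - v) by ring.
rewrite alg; apply: le_lt_trans (cabsD _ _) _; rewrite cabsM.
have := cabs_ge0 (w - z); lra.
Qed.

(* The term [e |z|^2] makes the modulus strictly subharmonic, so that the
   maximum cannot be attained inside the disk. *)
Lemma slope_perturbed_max f l (e r : R) : 0 < e -> 0 < r < 1 ->
  (forall z, disk z -> derivable f z 1) -> cdiff f 0 l -> f 0 = 0 ->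
  (forall z, disk z -> disk (f z)) ->
  forall z, cabs z <= r -> cabs (slope f 0 l z) ^+ 2 <= r ^- 2 + e.
Proof.
move=> e0 /andP[r0 r1] df fl f0 fd.
set X := slope f 0 l; pose u z := cabs (X z) ^+ 2 + e * cabs z ^+ 2.
have Xc z : cabs z < 1 -> ccont X z.
  move=> z1; have [->|z0] := eqVneq z 0.
    by move=> h h0; have [d d0 H] := slope_ccont 1 fl h0;
      exists d => // w /H; rewrite !mul1r.
  have [m Hm] := slope_cdiff l 1 (derivable_cdiff (df z z1)) z0.
  by move=> h h0; have [d d0 H] := cdiff_cont Hm h0;
    exists d => // w /H; rewrite !mul1r.
have sqr_rcont (g : Cplx R -> Cplx R) z : ccont g z -> rcont (fun w => cabs (g w) ^+ 2) z.
  move=> gz h h0; pose M := 2 * cabs (g z) + 1.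
  have M0 : 0 < M by have := cabs_ge0 (g z); rewrite /M; lra.
  have d0' : 0 < Num.min 1 (h / M) by rewrite lt_min ltr01 divr_gt0.
  have [d d0 H] := gz _ d0'; exists d => // w /H; rewrite lt_min ltr_pdivlMr//.
  move=> /andP[h1 h2]; rewrite subr_sqr normrM.
  have A := ler_cabs_dist (g w) (g z).
  have B : `|cabs (g w) + cabs (g z)| <= M.
    rewrite ger0_norm ?addr_ge0 ?cabs_ge0// /M.
    by move: A; rewrite ler_norml => /andP[_]; lra.
  exact: le_lt_trans (ler_pM (normr_ge0 _) (normr_ge0 _) A B) h2.
have [||z0 z0r zmax] := @closed_disk_max u r; first exact: ltW.
  move=> z zr h h0; have h20 : 0 < h / 2 by rewrite divr_gt0.
  have idc : ccont (@id (Cplx R)) z by move=> k k0; exists k.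
  have z1 : cabs z < 1 by exact: le_lt_trans r1.
  have [d1 d10 H1] := sqr_rcont _ _ (Xc _ z1) _ h20.
  have [d2 d20 H2] := sqr_rcont _ _ idc _ (divr_gt0 h20 e0).
  exists (Num.min d1 d2); first by rewrite lt_min d10.
  move=> w; rewrite lt_min => /andP[/H1 {}H1 /H2]; rewrite ltr_pdivlMr// => {}H2.
  rewrite /u; have -> : cabs (X w) ^+ 2 + e * cabs w ^+ 2 - (cabs (X z) ^+ 2 + e * cabs z ^+ 2)
    = (cabs (X w) ^+ 2 - cabs (X z) ^+ 2) + (cabs w ^+ 2 - cabs z ^+ 2) * e by ring.
  apply: le_lt_trans (ler_normD _ _) _; rewrite normrM (gtr0_norm e0); lra.
have [z0E|z0N] := eqVneq (cabs z0) r.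
  move=> z zr; have := zmax z zr; rewrite /u z0E.
  have -> : X z0 = f z0 / z0.
    rewrite /X /slope -cabs_eq0 z0E gt_eqF// f0 !subr0//.
  rewrite cabsM cabsV z0E exprMn exprVn.
  have f1 : cabs (f z0) ^+ 2 <= 1.
    by rewrite expr_le1// ?cabs_ge0//; apply/ltW/fd; rewrite /disk /= z0E.
  have r2 : 0 <= r ^- 2 by rewrite invr_ge0 sqr_ge0.
  have er : e * r ^+ 2 <= e by rewrite ler_piMr ?(ltW e0)// expr_le1// ltW.
  have ez : 0 <= e * cabs z ^+ 2 by rewrite mulr_ge0 ?(ltW e0)// sqr_ge0.
  have := ler_wpM2r r2 f1; lra.
have {}z0r : cabs z0 < r by rewrite lt_neqAle z0N.
exfalso.
(* The punctured disk about [z0] must avoid 0, the only point where [slope] is merely known to be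
   continuous, and must stay where [z0] is a maximum. *)
have [rho [rho0 rhor rhoz]] : exists rho : R, [/\ 0 < rho, rho <= r - cabs z0 &
    forall z, 0 < cabs (z - z0) < rho -> z != 0].
  have [z00|z00] := eqVneq z0 0.
    exists r; rewrite z00 cabs0 subr0; split => // z; rewrite subr0 cabs_gt0.
    by move=> /andP[].
  exists (Num.min (r - cabs z0) (cabs z0)); split.
  - by rewrite lt_min subr_gt0 z0r cabs_gt0.
  - by rewrite ge_min lexx.
  move=> z; rewrite lt_min => /andP[_ /andP[_]].
  by apply: contraTneq => ->; rewrite sub0r cabsN ltxx.
have near z : cabs (z - z0) < rho -> cabs z < r.
  by move=> zr; have := cabsD (z - z0) z0; rewrite subrK; lra.
(* Chosen so that [re (a * (z - z0))] is half of [e * (|z|^2 - |z0|^2 - |z - z0|^2)]. By maximality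
   of [u] at [z0], the real part of [g] on the circle of radius [rho / 2] is then below its central
   value by at least [e * (rho / 2)^2 / 2], against the mean value property. *)
pose a := cr e * conj z0.
pose g z := conj (X z0) * X z + a * (z - z0).
have gd z : 0 < cabs (z - z0) < rho -> exists m, cdiff g z m.
  move=> zz; have zN := rhoz _ zz; move: zz => /andP[_ /near zr].
  have z1 : disk z by exact: lt_trans r1.
  have [m Hm] := slope_cdiff l (conj (X z0)) (derivable_cdiff (df z z1)) zN.
  by exists (m + a); exact: cdiff_add_linear.
have gc : ccont g z0.
  apply: (@ccont_add_linear (fun z => conj (X z0) * X z)).
  have [z00|z00] := eqVneq z0 0; first by rewrite z00; exact: slope_ccont.
  have z1 : disk z0 by exact: lt_trans r1.
  have [m Hm] := slope_cdiff l (conj (X z0)) (derivable_cdiff (df z0 z1)) z00.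
  exact: cdiff_cont Hm.
pose s := ln (rho / 2).
have sE : expR s = rho / 2 by rewrite lnK// posrE divr_gt0.
have srho : expR s < rho by rewrite sE; lra.
have I := mean_value gd gc srho.
have g0 : re (g z0) = cabs (X z0) ^+ 2.
  by rewrite /g subrr mulr0 addr0 conjM re_cr.
have pi0 : 0 < 2 * pi :> R by rewrite mulr_gt0// pi_gt0.
have : re (g z0) * (2 * pi - 0) <= (cabs (X z0) ^+ 2 - e * (rho / 2) ^+ 2 / 2) * (2 * pi - 0).
  rewrite subr0 -I -[X in _ <= _ * X]subr0; apply: intg_le_cst; first exact: ltW.
    apply: circle_cont => z zs; apply: gd; rewrite zs srho expR_gt0//.
  move=> t _; set z := z0 + expc s t.
  have zz : z - z0 = expc s t by rewrite /z (addrC z0) addrK.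
  have := zmax z (ltW (near z _)); rewrite zz cabs_expc => /(_ srho).
  rewrite /u => uz.
  have A : re (conj (X z0) * X z) <= (cabs (X z0) ^+ 2 + cabs (X z) ^+ 2) / 2.
    apply: le_trans (ler_norm _) _; apply: le_trans (re_le _) _.
    rewrite cabsM cabs_conj.
    have := sqr_ge0 (cabs (X z0) - cabs (X z)); rewrite sqrrB; lra.
  have B : re (a * (z - z0)) = e * (cabs z ^+ 2 - cabs z0 ^+ 2 - cabs (z - z0) ^+ 2) / 2.
    rewrite !cabs_sqr /a.
    have cz : re (conj z0) = re z0 /\ im (conj z0) = - im z0 by case: (z0).
    by case: cz => c1 c2; rewrite !(reM, imM, reB, imB) re_cr im_cr c1 c2; field.
  rewrite /g reD B zz cabs_expc sE; lra.
rewrite subr0 ler_pM2r// g0.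
have : 0 < e * (rho / 2) ^+ 2 by rewrite mulr_gt0// exprn_gt0// divr_gt0.
lra.
Qed.

Lemma slope_le1 f l :
  (forall z, disk z -> derivable f z 1) -> cdiff f 0 l -> f 0 = 0 ->
  (forall z, disk z -> disk (f z)) ->
  forall z, disk z -> cabs (slope f 0 l z) <= 1.
Proof.
move=> df fl f0 fd z z1; rewrite leNgt; apply/negP => X1.
set X := cabs (slope f 0 l z) in X1; pose Y := X ^+ 2.
have Y1 : 1 < Y by rewrite /Y exprn_egt1.
(* Explicit choices in place of the limits [r -> 1] and [e -> 0]. Since [((1 + q) / 2)^2 >= q], one
   gets [r^-2 <= 1 / q = (1 + Y) / 2]; adding [(Y - 1) / 4] still gives less than [Y]. *)
pose q := 2 / (1 + Y); have q0 : 0 < q by rewrite divr_gt0//; lra.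
have q1 : q < 1 by rewrite ltr_pdivrMr; lra.
pose r := Num.max (cabs z) ((1 + q) / 2).
have r1 : r < 1 by rewrite /r gt_max (z1 : cabs z < 1)/=; lra.
have rq : (1 + q) / 2 <= r by rewrite le_max lexx orbT.
have zr : cabs z <= r by rewrite le_max lexx.
clearbody r.
have r0 : 0 < r by lra.
have e0 : 0 < (Y - 1) / 4 by rewrite divr_gt0//; lra.
have r01 : 0 < r < 1 by rewrite r0.
have := slope_perturbed_max e0 r01 df fl f0 fd zr; rewrite -/X -/Y.
have rr : q <= r ^+ 2.
  have : ((1 + q) / 2) ^+ 2 <= r ^+ 2 by rewrite ler_sqr ?nnegrE; lra.
  have := sqr_ge0 (1 - q); rewrite sqrrB expr1n expr2 !mul1r; lra.
have : r ^- 2 <= (1 + Y) / 2.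
  have -> : (1 + Y) / 2 = q^-1 by rewrite /q invf_div.
  by rewrite lef_pV2 ?posrE ?exprn_gt0.
lra.
Qed.

(** The real part of [conj l * slope] has mean 1 on the circle of radius [r] and never exceeds 1, so
    by continuity it equals 1 at the parameter [t = 0]. Modulus at most 1 then kills the imaginary
    part. Only that point, [cr r], is treated; other directions follow by rotating the variable. *)
Lemma schwarz_equality f l :
  (forall z, disk z -> derivable f z 1) -> cdiff f 0 l -> f 0 = 0 ->
  (forall z, disk z -> disk (f z)) -> 1 <= cabs l ->
  cabs l = 1 /\ forall r, 0 < r < 1 -> f (cr r) = l * cr r.
Proof.
move=> df fl f0 fd l1; set X := slope f 0 l.
have X0 : X 0 = l by rewrite /X /slope eqxx.
have le1 := slope_le1 df fl f0 fd.
have lE : cabs l = 1.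
  by apply/eqP; rewrite eq_le l1 andbT -X0; apply/le1/disk0.
split => // r /andP[r0 r1]; pose s := ln r; have sE : expR s = r by rewrite lnK.
have crE : cr r = expc s 0.
  by rewrite /cr /expc cos0 sin0 mulr1 mulr0 sE.
have gd z : 0 < cabs (z - 0) < 1 -> exists m, cdiff (fun w => conj l * X w) z m.
  rewrite subr0 cabs_gt0 => /andP[z0 z1].
  exact: slope_cdiff (derivable_cdiff (df z z1)) z0.
have s1 : expR s < 1 by rewrite sE.
have pi0 : 0 < 2 * pi :> R by rewrite mulr_gt0// pi_gt0.
have := mean_value gd (slope_ccont (conj l) fl) s1.
rewrite -/X X0 conjM lE expr1n re_cr => I.
have Z t : cabs (0 + expc s t) < 1 by rewrite add0r cabs_expc sE.
have gl1 t : cabs (conj l * X (0 + expc s t)) <= 1.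
  by rewrite cabsM cabs_conj lE mul1r; apply: le1; exact: Z.
have re1 : re (conj l * X (0 + expc s 0)) = 1.
  apply/eqP; rewrite eq_le (le_trans (ler_norm _) (le_trans (re_le _) (gl1 0)))/=.
  rewrite leNgt; apply/negP => lt1.
  have : intg 0 (2 * pi) (fun t => re (conj l * X (0 + expc s t))) < 1 * (2 * pi - 0).
    apply: (@intg_lt_cst _ _ _ _ _ 0) => //.
    - apply: (@circle_cont _ (fun w => conj l * X w)) => z; rewrite subr0 => zs.
      by apply: gd; rewrite subr0 zs s1 expR_gt0.
    - by move=> t _; exact: le_trans (ler_norm _) (le_trans (re_le _) (gl1 t)).
    - by rewrite lexx ltW.
  by rewrite I subr0 ltxx.
have im0 : im (conj l * X (0 + expc s 0)) = 0.
  apply/eqP; rewrite -sqrf_eq0 eq_le sqr_ge0 andbT.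
  have : cabs (conj l * X (0 + expc s 0)) ^+ 2 <= 1 by rewrite expr_le1// cabs_ge0.
  by rewrite cabs_sqr re1 expr1n; lra.
have : conj l * X (0 + expc s 0) = 1 by apply: re_inj.
rewrite add0r -crE => H.
have XE : X (cr r) = l.
  have : l * (conj l * X (cr r)) = l by rewrite H mulr1.
  by rewrite mulrA (mulrC l) conjM lE expr1n cr1 mul1r.
have cr0' : cr r != 0 by rewrite -cabs_eq0 cabs_cr normr_eq0 gt_eqF.
by rewrite -XE /X /slope (negbTE cr0') f0 !subr0 divfK.
Qed.

(** For [z != 0], precomposing with multiplication by the unit number [z / |z|] moves [z] to the
    positive real axis. *)
Lemma schwarz_rigidity f :
  (forall z, disk z -> derivable f z 1) -> f 0 = 0 ->
  (forall z, disk z -> disk (f z)) -> 1 <= cabs (derive1 f 0) ->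
  cabs (derive1 f 0) = 1 /\ forall z, disk z -> f z = derive1 f 0 * z.
Proof.
move=> df f0 fd l1; set l := derive1 f 0 in l1 *.
have fl : cdiff f 0 l by apply/derivable_cdiff/df/disk0.
have [lE _] := schwarz_equality df fl f0 fd l1; split => // z z1.
have [->|z0] := eqVneq z 0; first by rewrite mulr0.
have rz : 0 < cabs z by rewrite cabs_gt0.
pose v := z / cr (cabs z).
have crz : cr (cabs z) != 0 by rewrite -cabs_eq0 cabs_cr normr_eq0 gt_eqF.
have v1 : cabs v = 1.
  by rewrite /v cabsM cabsV cabs_cr ger0_norm ?cabs_ge0// divff// gt_eqF.
have vd w k : cdiff f (v * w) k -> cdiff (f \o (fun y => v * y)) w (k * v).
  move=> fk; apply: cdiff_comp => //.
  by move=> e e0; exists 1 => // y _; rewrite -mulrBr subrr cabs0 mulr_ge0 ?cabs_ge0 ?ltW.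
have vdisk w : disk w -> disk (v * w) by rewrite /disk /= cabsM v1 mul1r.
have [] := @schwarz_equality (f \o (fun y => v * y)) (l * v).
- move=> w w1; have := vd w _ (derivable_cdiff (df _ (vdisk w w1))).
  by move=> /cdiff_derive1[].
- by apply: vd; rewrite mulr0.
- by rewrite /= mulr0.
- by move=> w w1; apply/fd/vdisk.
- by rewrite cabsM v1 mulr1.
move=> _ /(_ (cabs z)); rewrite rz => /(_ z1) /=.
have -> : v * cr (cabs z) = z by rewrite divfK.
by move=> ->; rewrite -mulrA divfK.
Qed.

End Schwarz.

(** * Area in the plane *)

Section PlanarLebesgue.
Context {R : realType}.
Notation leb := (@lebesgue_measure R).
Notation line := (measurableTypeR R).
Notation plane := (measurableTypeR R * measurableTypeR R)%type.

Definition affine (k m : R) (y : line) : line := k * y + m.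

Lemma affine_measurable (k m : R) : measurable_fun [set: line] (affine k m).
Proof.
apply: (@measurable_funD _ line R setT (fun y => k * y) (cst m)).
  exact: mulrl_measurable.
exact: measurable_cst.
Qed.

(** By uniqueness of Lebesgue measure it is enough to compare with [|k|] times the push-forward on
    half-open intervals. For [k < 0] the preimage is closed on the other side but has the same
    length. *)
Lemma lebesgue_affine (k m : R) (A : set line) : k != 0 -> measurable A ->
  leb (affine k m @^-1` A) = ((`|k|^-1)%:E * leb A)%E.
Proof.
move=> k0 mA; have mT := affine_measurable k m.
pose mu := mscale (NngNum (normr_ge0 k))
  (measure_function_pushforward__canonical__measure_function_Measure leb mT).
have -> : leb A = (`|k|%:E * leb (affine k m @^-1` A))%E.
  apply: (@lebesgue_measure_unique R mu) => // _ /ocitvP[->|[[a b] /= ab ->]].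
    by rewrite measure0; apply/esym; exact: measure0.
  rewrite /mu /mscale /= /pushforward.
  have [kp|kn] : 0 < k \/ k < 0 by move: k0; rewrite neq_lt => /orP[]; [right|left].
    have -> : affine k m @^-1` `]a, b]%classic = `](a - m) / k, (b - m) / k]%classic.
      apply/seteqP; split => y; rewrite /= /affine !in_itv /= ltr_pdivrMr// ler_pdivlMr//;
      by rewrite ltrBlDr lerBrDr mulrC.
    rewrite !lebesgue_measure_itv /= !lte_fin ab ltr_pM2r ?invr_gt0// ltrD2r ab.
    rewrite gtr0_norm// -!EFinD -EFinM; congr EFin; field; exact: k0.
  have -> : affine k m @^-1` `]a, b]%classic = `[(b - m) / k, (a - m) / k[%classic.
    apply/seteqP; split => y; rewrite /= /affine !in_itv /= ltr_ndivlMr// ler_ndivrMr//;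
    by rewrite ltrBlDr lerBrDr mulrC andbC.
  rewrite !lebesgue_measure_itv /= !lte_fin ab ltr_nM2r ?invr_lt0// ltrD2r ab.
  rewrite ltr0_norm// -!EFinD -EFinM; congr EFin; field; exact: k0.
by rewrite muleA -EFinM mulVf ?mul1e// normr_eq0.
Qed.

Lemma affine_plane_measurable (a b c : R) :
  measurable_fun [set: plane] (fun w : plane => a * w.1 + b * w.2 + c : line).
Proof.
apply: measurable_funD; last exact: measurable_cst.
by apply: measurable_funD; apply: measurable_funM; rewrite //=.
Qed.

Lemma measurable_preimageT d d' (T : measurableType d) (U : measurableType d')
  (f : T -> U) A : measurable_fun setT f -> measurable A -> measurable (f @^-1` A).
Proof. by move=> mf mA; rewrite -[_ @^-1` _]setTI; exact: mf. Qed.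

(** The shear acts on each vertical section as an affine map with ratio [k], so the sections scale
    uniformly. *)
Lemma shear2_measure (k l m : R) (A : set plane) : k != 0 -> measurable A ->
  (leb \x leb)%E ((fun w : plane => (w.1, l * w.1 + k * w.2 + m) : plane) @^-1` A) =
  ((`|k|^-1)%:E * (leb \x leb)%E A)%E.
Proof.
move=> k0 mA; rewrite /product_measure1 -ge0_integralZl//.
- apply: eq_integral => x _ /=.
  rewrite -(lebesgue_affine (l * x + m) k0); last exact: measurable_xsection.
  have E y : affine k (l * x + m) y = l * x + k * y + m by rewrite /affine; ring.
  by congr (leb _); apply/seteqP; split => y; rewrite /xsection /= !inE /= E.
- exact: measurable_fun_xsection.
Qed.

(** Lets the other shear be computed on horizontal sections. *)
Lemma product_measure12 (A : set plane) : measurable A ->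
  (leb \x leb)%E A = (leb \x^ leb)%E A.
Proof.
apply: product_measure_unique => B C mB mC; exact: product_measure2E.
Qed.

Lemma shear1_measure (k l m : R) (A : set plane) : k != 0 -> measurable A ->
  (leb \x leb)%E ((fun w : plane => (k * w.1 + l * w.2 + m, w.2) : plane) @^-1` A) =
  ((`|k|^-1)%:E * (leb \x leb)%E A)%E.
Proof.
move=> k0 mA; rewrite !product_measure12//; last first.
  apply: measurable_preimageT => //; apply: measurable_fun_pair.
    exact: affine_plane_measurable.
  exact: measurable_snd.
rewrite /product_measure2 -ge0_integralZl//.
- apply: eq_integral => y _ /=.
  rewrite -(lebesgue_affine (l * y + m) k0); last exact: measurable_ysection.
  have E x : affine k (l * y + m) x = k * x + l * y + m by rewrite /affine; ring.
  by congr (leb _); apply/seteqP; split => x; rewrite /ysection /= !inE /= E.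
- exact: measurable_fun_ysection.
Qed.

Lemma xy_to_C_inj : injective (@xy_to_C R).
Proof. by move=> [a b] [c d] [-> ->]. Qed.

Definition simil (q b : Cplx R) (w : plane) : plane :=
  (re q * w.1 + - im q * w.2 + re b, im q * w.1 + re q * w.2 + im b).

Lemma similE q b w : xy_to_C (simil q b w) = q * xy_to_C w + b.
Proof.
by apply: re_inj; rewrite ?reD ?imD ?reM ?imM /re /im /=; ring.
Qed.

Lemma simil_measurable q b : measurable_fun setT (simil q b).
Proof. by apply: measurable_fun_pair; exact: affine_plane_measurable. Qed.

(** For [q = x + iy], the matrix with rows [(x, -y)] and [(y, x)] is the product of those with rows
    [(k, l), (0, 1)] and [(1, 0), (y, x)], where [k = |q|^2 / x] and [l = -y / x]. This requires
    [x != 0], and the area factors combine to [|k x| = |q|^2]. *)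
Let simil_measure_re q b (A : set plane) : re q != 0 -> measurable A ->
  (leb \x leb)%E (simil q b @^-1` A) = ((cabs q ^- 2)%:E * (leb \x leb)%E A)%E.
Proof.
move=> a0 mA; pose S1 (w : plane) : plane := (w.1, im q * w.1 + re q * w.2 + im b).
pose k := cabs q ^+ 2 / re q; pose l := - im q / re q.
pose S2 (w : plane) : plane := (k * w.1 + l * w.2 + (re b + im q * im b / re q), w.2).
have q0 : q != 0 by apply: contraNneq a0 => ->.
have k0 : k != 0 by rewrite mulf_neq0 ?invr_eq0// expf_neq0// cabs_eq0.
have -> : simil q b @^-1` A = S1 @^-1` (S2 @^-1` A).
  rewrite -comp_preimage; congr (_ @^-1` A); apply/funext => -[x y].
  by rewrite /simil /S1 /S2 /= /k /l cabs_sqr; congr pair; field.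
rewrite shear2_measure//; last first.
  apply: measurable_preimageT => //; apply: measurable_fun_pair.
    exact: affine_plane_measurable.
  exact: measurable_snd.
rewrite shear1_measure// muleA -EFinM; congr ((_)%:E * _)%E.
rewrite /k normrM normfV normrX (ger0_norm (cabs_ge0 q)); field.
by rewrite cabs_eq0 q0 normr_eq0.
Qed.

Lemma simil_measure q b (A : set plane) : q != 0 -> measurable A ->
  (leb \x leb)%E (simil q b @^-1` A) = ((cabs q ^- 2)%:E * (leb \x leb)%E A)%E.
Proof.
move=> q0 mA; have [a0|] := eqVneq (re q) 0; last by move=> ?; exact: simil_measure_re.
(* a purely imaginary factor is the product of two factors off the imaginary axis *)
pose u : Cplx R := (1 +i* 1)%C; pose v := q / u.
have u0 : u != 0.
  by apply/eqP => /(congr1 re)/eqP; rewrite /re /= oner_eq0.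
have quv : q = v * u by rewrite divfK.
have ru : re u != 0 by rewrite /re /= oner_eq0.
have iq : im q != 0.
  by apply: contraNneq q0 => iq0; apply/eqP/re_inj.
have rv : re v != 0.
  have E : re v + re v = im q.
    have A1 : re q = re v - im v by rewrite quv reM /re /im /= !mulr1.
    have A2 : im q = re v + im v by rewrite quv imM /re /im /= !mulr1.
    by rewrite A2; congr (_ + _); apply/eqP; rewrite -subr_eq0 -A1 a0.
  by apply: contraNneq iq => rv0; rewrite -E rv0 addr0.
have -> : simil q b @^-1` A = simil u 0 @^-1` (simil v b @^-1` A).
  rewrite -comp_preimage; congr (_ @^-1` A); apply/funext => w.
  by apply: xy_to_C_inj; rewrite /comp !similE addr0 mulrA -quv.
rewrite simil_measure_re//; last first.
  by apply: measurable_preimageT => //; exact: simil_measurable.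
rewrite simil_measure_re// muleA -EFinM; congr ((_)%:E * _)%E.
have -> : cabs q = cabs v * cabs u by rewrite -cabsM -quv.
by rewrite exprMn [RHS]invfM mulrC.
Qed.

Lemma area_simil q b (D : set plane) (f : plane -> \bar R) : q != 0 ->
  measurable D -> measurable_fun D f -> (forall w : plane, D w -> (0 <= f w)%E) ->
  (\int[area]_(w in simil q b @^-1` D) f (simil q b w) =
   (cabs q ^- 2)%:E * \int[area]_(w in D) f w)%E.
Proof.
move=> q0 mD mf f0; have mS := simil_measurable q b.
have q2 : 0 <= cabs q ^- 2 by rewrite invr_ge0 sqr_ge0.
rewrite -[LHS](@ge0_integral_pushforward _ _ _ _ _ _ mS area)//; last first.
  by move=> y /set_mem; exact: f0.
rewrite -[RHS](@ge0_integral_mscale _ _ _ _ _ mD (NngNum q2) f)//.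
apply: (@eq_measure_integral _ _ _ _ (mscale (NngNum q2) area)
 (measure_function_pushforward__canonical__measure_function_Measure area mS)) => A mA _.
rewrite /= /pushforward /area /mscale /= simil_measure//.
by rewrite !muleA -!EFinM mulrC.
Qed.

(** The product sigma-algebra is generated by rectangles, so [A] is written as a countable union of
    the boxes with rational centre and half-side [1 / (n + 1)] that it contains. *)
Lemma open_plane_measurable (A : set plane) :
  (forall w, A w -> exists2 d : R, 0 < d & forall v : plane,
     `|v.1 - w.1| < d -> `|v.2 - w.2| < d -> A v) -> measurable A.
Proof.
move=> Aop.
pose box (a b : rat) (c : R) : set plane :=
  `]ratr a - c, ratr a + c[ `*` `]ratr b - c, ratr b + c[.
have mbox a b c : measurable (box a b c) by apply: measurableX; exact: measurable_itv.
rewrite (_ : A = \bigcup_(a : rat) \bigcup_(b : rat) \bigcup_n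
   (if `[< box a b n.+1%:R^-1 `<=` A >] then box a b n.+1%:R^-1 else set0)).
  apply: bigcupT_measurable_rat => a; apply: bigcupT_measurable_rat => b.
  by apply: bigcupT_measurable => n; case: ifP.
apply/seteqP; split=> [w Aw|w [a _ [b _ [n _]]]]; last by case: asboolP => // H /H.
have [d d0 H] := Aop w Aw.
(* The centre lies within [c] of [w] and the box reaches [c] further, so [2 c < d] keeps the box in
   [A]. *)
have [n] : exists n : nat, (n.+1%:R^-1 : R) < d / 2.
  have d20 : 0 < d / 2 by rewrite divr_gt0.
  by have [n] := ltr_add_invr d20; rewrite add0r; exists n.
have : 0 < (n.+1%:R^-1 : R) by rewrite invr_gt0.
set c := (n.+1%:R^-1 : R) => c0 cd.
have pick (x : R) : exists a : rat, x - c < ratr a < x + c.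
  have : x - c < x + c by lra.
  by move=> /rat_in_itvoo[a]; rewrite in_itv /=; exists a.
have [a /andP[a1 a2]] := pick w.1; have [b /andP[b1 b2]] := pick w.2.
exists a => //; exists b => //; exists n => //; rewrite -/c; clearbody c.
have bw : box a b c w.
  by split; rewrite /= in_itv /=; apply/andP; split; lra.
rewrite asboolT// => v [] /=; rewrite !in_itv /= => /andP[v1 v2] /andP[v3 v4].
by apply: H; rewrite ltr_norml; apply/andP; split; lra.
Qed.

Lemma rcont_open (g : Cplx R -> R) (D : set (Cplx R)) (a : R) :
  (forall z, D z -> exists2 d : R, 0 < d & forall w, cabs (w - z) < d -> D w) ->
  (forall z, D z -> rcont g z) ->
  measurable (xy_to_C @^-1` (D `&` [set z | a < g z]) : set plane).
Proof.
move=> Dop gc; apply: open_plane_measurable => w [Dw gw] /=.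
have [d1 d10 H1] := Dop _ Dw.
have [|d2 d20 H2] := gc _ Dw (g (xy_to_C w) - a); first by rewrite subr_gt0.
exists (Num.min d1 d2 / 2); first by rewrite divr_gt0// lt_min d10.
move=> v v1 v2.
have N : cabs (xy_to_C v - xy_to_C w) <= `|v.1 - w.1| + `|v.2 - w.2| := cabs_le _.
have : cabs (xy_to_C v - xy_to_C w) < Num.min d1 d2.
  by apply: le_lt_trans N _; rewrite (splitr (Num.min d1 d2)) ltrD.
rewrite lt_min => /andP[/H1 Dv /H2]; rewrite ltr_norml => /andP[gv _].
by split => //=; lra.
Qed.

Lemma rcont_measurable (g : Cplx R -> R) (D : set (Cplx R)) :
  (forall z, D z -> exists2 d : R, 0 < d & forall w, cabs (w - z) < d -> D w) ->
  (forall z, D z -> rcont g z) ->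
  measurable_fun (xy_to_C @^-1` D : set plane) (g \o @xy_to_C R).
Proof.
move=> Dop gc mD; apply: (measurability _ (RGenOInfty.measurableE R)) => //.
move=> /= _ [_ [a ->] <-]; rewrite preimage_itvoy.
exact: (rcont_open a Dop gc).
Qed.

Definition cball (c : Cplx R) (r : R) : set (Cplx R) := [set z | cabs (z - c) < r].

Lemma cball_open c r z : cball c r z ->
  exists2 d : R, 0 < d & forall w, cabs (w - z) < d -> cball c r w.
Proof.
rewrite /cball /= => zr; exists (r - cabs (z - c)); first by rewrite subr_gt0.
move=> w wz; have := cabsD (w - z) (z - c); rewrite addrA subrK; lra.
Qed.

Lemma cball_measurable c r : measurable (xy_to_C @^-1` (cball c r) : set plane).
Proof.
have := @rcont_open (fun=> 1) (cball c r) 0 (@cball_open c r).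
have -> : cball c r `&` [set z | 0 < (1 : R)] = cball c r.
  by apply/seteqP; split=> [z []|z] //; split => //=; exact: ltr01.
by apply => z _ e e0; exists 1 => // w _; rewrite subrr normr0.
Qed.

Lemma disk_cball : @disk R = cball 0 1.
Proof. by apply/seteqP; split=> z; rewrite /cball /disk /= subr0. Qed.

End PlanarLebesgue.

(** * Integrability of the weight *)

Section Weight.
Context {R : realType}.
Notation leb := (@lebesgue_measure R).
Notation plane := (measurableTypeR R * measurableTypeR R)%type.
Implicit Types (z : Cplx R) (p r : R).

Lemma pdisk_measurable : measurable (xy_to_C @^-1` disk : set plane).
Proof. by rewrite disk_cball; exact: cball_measurable. Qed.

Lemma areaE (A : set plane) : area A = ((pi : R)^-1%:E * (leb \x leb)%E A)%E.
Proof. by []. Qed.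

Definition disk_area : \bar R := area (xy_to_C @^-1` disk : set plane).

Lemma area_cball (c : Cplx R) r : 0 < r ->
  area (xy_to_C @^-1` (cball c r) : set plane) = ((r ^+ 2)%:E * disk_area)%E.
Proof.
move=> r0; have q0 : cr r^-1 != 0 by rewrite -cabs_eq0 cabs_cr normr_eq0 invr_eq0 gt_eqF.
have -> : (xy_to_C @^-1` (cball c r) : set plane) =
    simil (cr r^-1) (- (cr r^-1 * c)) @^-1` (xy_to_C @^-1` disk).
  have E (w : plane) : cabs (xy_to_C (simil (cr r^-1) (- (cr r^-1 * c)) w)) < 1 <->
      cabs (xy_to_C w - c) < r.
    rewrite similE -mulrBr cabsM cabs_cr ger0_norm ?invr_ge0 ?(ltW r0)//.
    by rewrite ltr_pdivrMl// mulr1.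
  by apply/seteqP; split=> w /E.
rewrite /disk_area !areaE simil_measure//; last exact: pdisk_measurable.
by rewrite cabs_cr ger0_norm ?invr_ge0 ?(ltW r0)// exprVn invrK !muleA -!EFinM mulrC.
Qed.

(** Comparison with the squares of half-side [1/4] inside and 1 outside. *)
Lemma disk_area_bounds : (0 < disk_area < +oo)%E.
Proof.
have box (a : R) : 0 < a ->
    (leb \x leb)%E (`[- a, a]%classic `*` `[- a, a]%classic : set plane) = ((2 * a) ^+ 2)%:E.
  move=> a0; rewrite product_measure1E//; [|exact: measurable_itv..].
  have lE : leb `[- a, a]%classic = (2 * a)%:E.
    have -> : leb `[- a, a]%classic = (if ((- a)%:E < a%:E)%E then a%:E - (- a)%:E else 0)%E.
      exact: lebesgue_measure_itv.
    rewrite lte_fin; case: ltP => [_|h]; last by exfalso; lra.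
    by rewrite -EFinB opprK mulr_natl mulr2n.
  rewrite expr2 EFinM; congr (_ * _)%E; exact: lE.
have pi0 : 0 < (pi : R)^-1 by rewrite invr_gt0 pi_gt0.
have mbox (a : R) : measurable (`[- a, a]%classic `*` `[- a, a]%classic : set plane).
  by apply: measurableX; exact: measurable_itv.
apply/andP; split; rewrite /disk_area areaE.
  apply: mule_gt0; first by rewrite lte_fin.
  apply: (@lt_le_trans _ _ ((2 * 4^-1) ^+ 2)%:E); first by rewrite lte_fin exprn_gt0//; lra.
  rewrite -box//; apply: le_measure; rewrite ?inE//; [exact: pdisk_measurable|].
  move=> w [] /=; rewrite !in_itv /= -!ler_norml => w1 w2.
  have N : cabs (xy_to_C w) <= `|w.1| + `|w.2| := cabs_le _.
  by rewrite /disk /preimage /mkset; apply: le_lt_trans N _; lra.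
apply: lte_mul_pinfty; rewrite ?lee_fin ?(ltW pi0)//.
apply: (@le_lt_trans _ _ ((2 * 1) ^+ 2)%:E); last exact: ltry.
rewrite -box//; apply: le_measure; rewrite ?inE//; [exact: pdisk_measurable|].
move=> w wd; split; rewrite /= in_itv /= -ler_norml.
  exact: le_trans (re_le (xy_to_C w)) (ltW wd).
exact: le_trans (im_le (xy_to_C w)) (ltW wd).
Qed.

Definition weight p z : R := (1 - cabs z ^+ 2) `^ (p - 2).

Lemma le0_ger_powR (s x y : R) : s <= 0 -> 0 < x -> x <= y -> y `^ s <= x `^ s.
Proof.
move=> s0 x0 xy; have y0 : 0 < y := lt_le_trans x0 xy.
have [t ts] : exists t, s = - t by exists (- s); rewrite opprK.
rewrite ts !powRN lef_pV2 ?posrE ?powR_gt0// ge0_ler_powR ?nnegrE ?(ltW x0) ?(ltW y0)//.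
by rewrite -oppr_le0 -ts.
Qed.

Lemma weight_ge0 p z : 0 <= weight p z. Proof. exact: powR_ge0. Qed.

Lemma disk_sqr_lt1 z : disk z -> cabs z ^+ 2 < 1.
Proof. by move=> z1; rewrite expr_lt1// cabs_ge0. Qed.

Lemma weight_ge1 p z : p < 2 -> disk z -> 1 <= weight p z.
Proof.
move=> p2 /disk_sqr_lt1 z1; apply: (@le_trans _ _ (1 `^ (p - 2))); first by rewrite powR1.
apply: le0_ger_powR; first by rewrite subr_le0 ltW.
  by rewrite subr_gt0.
by rewrite lerBlDr lerDl sqr_ge0.
Qed.

Lemma weight_measurable p : measurable_fun (xy_to_C @^-1` disk : set plane)
  (fun w : plane => weight p (xy_to_C w)).
Proof.
apply: (@measurableT_comp _ _ _ _ _ _ (@powR R ^~ (p - 2)) _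
  (fun w : plane => 1 - cabs (xy_to_C w) ^+ 2)); first exact: measurable_powR.
rewrite disk_cball; apply: (@rcont_measurable R (fun z => 1 - cabs z ^+ 2)).
  exact: cball_open.
move=> z _ e e0; have c0 := cabs_ge0 z.
have M0 : 0 < 2 * cabs z + 1 by lra.
exists (Num.min 1 (e / (2 * cabs z + 1))); first by rewrite lt_min ltr01 divr_gt0.
move=> w; rewrite lt_min ltr_pdivlMr// => /andP[w1 we].
have N := ler_cabs_dist w z.
have -> : 1 - cabs w ^+ 2 - (1 - cabs z ^+ 2) = - ((cabs w - cabs z) * (cabs w + cabs z)).
  by ring.
rewrite normrN normrM; apply: le_lt_trans we; apply: ler_pM => //.
rewrite ger0_norm ?addr_ge0 ?cabs_ge0//.
by move: N; rewrite ler_norml => /andP[_]; lra.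
Qed.

(* On the dyadic annulus [1 - 2^-n <= |z| < 1 - 2^-(n+1)] the weight is at most
   [2^((n+1)(2-p))], while the area of the annulus is of order [2^-n]. *)
Lemma weight_integrable p : 1 < p < 2 ->
  (\int[area]_(w in (xy_to_C @^-1` disk : set plane)) (weight p (xy_to_C w))%:E < +oo)%E.
Proof.
move=> /andP[p1 p2].
pose q n : R := 2^-1 ^+ n.
have q0 n : 0 < q n by rewrite exprn_gt0// invr_gt0.
have q1 n : q n <= 1 by rewrite exprn_ile1// ?invr_ge0// invf_le1// ler1n.
have qS n : q n = q n.+1 + q n.+1 by rewrite /q exprS; lra.
pose B n : set plane := xy_to_C @^-1` cball 0 (1 - q n).
have BE n (w : plane) : B n w <-> cabs (xy_to_C w) < 1 - q n by rewrite /B /preimage /cball /mkset subr0.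
pose A n : set plane := B n.+1 `\` B n.
have mB n : measurable (B n) by exact: cball_measurable.
have mA n : measurable (A n) by exact: measurableD.
have qlim (d : R) : 0 < d -> exists n, q n < d.
  move=> d0; have : (fun n => 2^-1 ^+ n : R) @ \oo --> (0 : R).
    by apply: cvg_expr; rewrite ger0_norm; lra.
  move=> /cvgrPdist_lt/(_ _ d0)[n _ /(_ n)] /= H.
  by exists n; move: (H (leqnn n)); rewrite sub0r normrN ger0_norm// ltW.
have dA : (xy_to_C @^-1` disk : set plane) = \bigcup_n A n.
  apply/seteqP; split=> [w wd|w [n _ [/BE wn _]]]; last first.
    by rewrite /disk /preimage /mkset; have := q0 n.+1; lra.
  have [n0 n0q] : exists n, cabs (xy_to_C w) < 1 - q n.
    have [|n nq] := qlim (1 - cabs (xy_to_C w)); first by rewrite subr_gt0.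
    by exists n; lra.
  elim: n0 n0q => [|n IH] nq.
    by have := cabs_ge0 (xy_to_C w); move: nq; rewrite /q expr0 subrr; lra.
  have [/IH//|wn] := ltP (cabs (xy_to_C w)) (1 - q n).
  exists n => //; split; first exact/BE.
  by move/BE; rewrite ltNge wn.
have tA : trivIset setT A.
  apply/trivIsetP => i j _ _.
  wlog ij : i j / (i < j)%N => [H|_].
    rewrite neq_lt => /orP[ij|ij]; first by apply: H => //; rewrite neq_lt ij.
    by rewrite setIC; apply: H => //; rewrite neq_lt ij.
  apply/seteqP; split => // w [[/BE wi _] [_ /BE wj]]; apply: wj.
  apply: lt_le_trans wi _; rewrite lerD2l lerN2 /q.
  by rewrite ler_wiXn2l// ?invr_ge0// invf_le1// ler1n.
have wle n (w : plane) : A n w -> weight p (xy_to_C w) <= q n.+1 `^ (p - 2).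
  move=> [/BE w1 _]; rewrite /weight.
  have c0 := cabs_ge0 (xy_to_C w).
  have c2 : cabs (xy_to_C w) ^+ 2 <= cabs (xy_to_C w).
    by rewrite expr2 ler_piMr//; have := q0 n.+1; lra.
  by apply: le0_ger_powR => //; lra.
have mw := weight_measurable p.
have [a aE] : exists2 a : R, 0 < a & disk_area = a%:E.
  have /andP[a0 ay] := disk_area_bounds.
  exists (fine disk_area); last by rewrite fineK// ge0_fin_numE// ltW.
  by rewrite fine_gt0// a0.
move=> daE.
have areaB n : area (B n) = ((1 - q n) ^+ 2 * a)%:E.
  case: n => [|n].
    have -> : B 0%N = set0.
      apply/seteqP; split => // w /BE; rewrite /q expr0 subrr.
      by rewrite ltNge cabs_ge0.
    by rewrite measure0 /q expr0 subrr expr0n mul0r.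
  rewrite area_cball ?daE ?EFinM// subr_gt0 /q exprn_ilt1// ?invr_ge0//.
  by rewrite invf_lt1// ltr1n.
have areaA n : (area (A n) <= (2 * q n * a)%:E)%E.
  have BA : B n.+1 = B n `|` A n.
    rewrite /A setDUK// => w /BE wn; apply/BE; apply: lt_le_trans wn _.
    by have := q0 n.+1; have := qS n; lra.
  have H : (area (B n.+1) = area (B n) + area (A n))%E.
    rewrite BA; apply: measureU => //.
    by apply/seteqP; split => // w [? []].
  rewrite !areaB in H.
  have E : area (A n) = ((1 - q n.+1) ^+ 2 * a - (1 - q n) ^+ 2 * a)%:E.
    by rewrite EFinB H [X in (X - _)%E]addeC addeK.
  rewrite E lee_fin -mulrBl ler_pM2r// subr_sqr.
  have := qS n; have := q0 n.+1; have := q1 n; move=> h1 h2 h3.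
  have : (1 - q n.+1 - (1 - q n)) * (1 - q n.+1 + (1 - q n)) <= q n * 2.
    by apply: ler_pM; lra.
  by rewrite [q n * 2]mulrC.
pose rho : R := 2^-1 `^ (p - 1).
have rho0 : 0 < rho by rewrite powR_gt0// invr_gt0.
have rho1 : rho < 1.
  have := @gt0_ltr_powR R (p - 1) _ 2^-1 1; rewrite powR1; apply; rewrite ?nnegrE//.
  - by rewrite subr_gt0.
  - by rewrite invf_lt1// ltr1n.
have qrho n : q n `^ (p - 1) = rho ^+ n.
  elim: n => [|n IH]; first by rewrite /q !expr0 powR1.
  by rewrite /q exprS powRM ?invr_ge0 ?exprn_ge0 ?invr_ge0// -/(q n) IH -exprS.
have qrho2 n : q n.+1 `^ (p - 2) * q n = 2 * rho ^+ n.+1.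
  rewrite -qrho; have -> : p - 1 = (p - 2) + 1 by ring.
  rewrite (@powRD _ _ (p - 2) 1) ?(gt_eqF (q0 _)) ?implybT// powRr1 ?(ltW (q0 _))// (qS n); ring.
(* The sum of the bounds [4 * a * rho ^+ n.+1] for the annuli; the partial sums below are
   [K * (1 - rho ^+ N)]. *)
pose K := 4 * a * rho / (1 - rho).
have K0 : 0 <= K by rewrite /K divr_ge0 ?mulr_ge0 ?(ltW rho0) ?(ltW aE)// subr_ge0 ltW.
have int n : (\int[area]_(w in A n) (weight p (xy_to_C w))%:E <= (K * (1 - rho) * rho ^+ n)%:E)%E.
  have KE : K * (1 - rho) * rho ^+ n = q n.+1 `^ (p - 2) * (2 * q n * a).
    transitivity (2 * a * (q n.+1 `^ (p - 2) * q n)); last by ring.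
    by rewrite qrho2 /K divfK ?exprS; [ring|rewrite subr_eq0 gt_eqF].
  rewrite KE EFinM; apply: (@le_trans _ _ (\int[area]_(w in A n) (cst (q n.+1 `^ (p - 2))%:E w))%E).
    apply: ge0_le_integral => //.
    - by move=> w _; rewrite lee_fin powR_ge0.
    - apply/measurable_EFinP; apply: measurable_funS mw; first exact: pdisk_measurable.
      by rewrite dA => w Aw; exists n.
    - by move=> w Aw; rewrite lee_fin; exact: wle.
  by rewrite integral_cst// lee_wpmul2l// lee_fin powR_ge0.
have mwA : measurable_fun (\bigcup_n A n) (fun w : plane => (weight p (xy_to_C w))%:E).
  by rewrite -dA; apply/measurable_EFinP.
rewrite dA ge0_integral_bigcup//; last by move=> w _; rewrite lee_fin powR_ge0.
apply: (@le_lt_trans _ _ K%:E); last exact: ltry.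
apply: lime_le.
  by apply: is_cvg_nneseries => n _ _; apply: integral_ge0 => w _; rewrite lee_fin powR_ge0.
apply: nearW => N; apply: (@le_trans _ _ (K * (1 - rho ^+ N))%:E); last first.
  by rewrite lee_fin ler_piMr// lerBlDr lerDl exprn_ge0// ltW.
elim: N => [|N IH]; first by rewrite big_nil expr0 subrr mulr0.
rewrite big_nat_recr//=; apply: le_trans (leeD IH (int N)) _.
by rewrite -EFinD lee_fin exprS; lra.
Qed.

End Weight.

(** * Moments and bumps *)

Section Moments.
Context d (T : measurableType d) (R : realType) (mu : {measure set T -> \bar R}).

(* The nonnegative integrals of [(1-X)^N X^k v] satisfy the recursion
   [I(N+1,k) + I(N,k+1) = I(N,k)], so they are determined by the moments. *)
Lemma moments_onem (D : set T) (X Y u v : T -> R) : measurable D ->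
  measurable_fun D X -> measurable_fun D Y ->
  measurable_fun D u -> measurable_fun D v ->
  (forall x, D x -> 0 <= X x <= 1) -> (forall x, D x -> 0 <= Y x <= 1) ->
  (forall x, D x -> 0 <= u x) -> (forall x, D x -> 0 <= v x) ->
  (\int[mu]_(x in D) (v x)%:E < +oo)%E ->
  (forall n, \int[mu]_(x in D) (X x ^+ n * u x)%:E =
             \int[mu]_(x in D) (Y x ^+ n * v x)%:E)%E ->
  forall N, (\int[mu]_(x in D) ((1 - X x) ^+ N * u x)%:E =
             \int[mu]_(x in D) ((1 - Y x) ^+ N * v x)%:E)%E.
Proof.
move=> mD mX mY mu' mv X01 Y01 u0 v0 vfin XY.
pose F (Z w : T -> R) N k x := (1 - Z x) ^+ N * Z x ^+ k * w x.
have F0 (Z w : T -> R) N k x : 0 <= Z x <= 1 -> 0 <= w x -> 0 <= F Z w N k x.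
  by move=> /andP[Z0 Z1] w0; rewrite /F !mulr_ge0// exprn_ge0// subr_ge0.
have mF (Z w : T -> R) N k : measurable_fun D Z -> measurable_fun D w ->
    measurable_fun D (fun x => (F Z w N k x)%:E).
  move=> mZ mw; apply/measurable_EFinP; apply: measurable_funM => //.
  by apply: measurable_funM; apply: measurable_funX => //; apply: measurable_funB.
have rec (Z w : T -> R) N k : measurable_fun D Z -> measurable_fun D w ->
    (forall x, D x -> 0 <= Z x <= 1) -> (forall x, D x -> 0 <= w x) ->
    (\int[mu]_(x in D) (F Z w N k x)%:E =
     \int[mu]_(x in D) (F Z w N.+1 k x)%:E + \int[mu]_(x in D) (F Z w N k.+1 x)%:E)%E.
  move=> mZ mw Z01 w0; rewrite -ge0_integralD//; first last.
  - exact: mF.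
  - by move=> x Dx; rewrite lee_fin F0 ?Z01 ?w0.
  - exact: mF.
  - by move=> x Dx; rewrite lee_fin F0 ?Z01 ?w0.
  by apply: eq_integral => x _; rewrite -EFinD; congr EFin; rewrite /F !exprS; ring.
have Ffin N k : (\int[mu]_(x in D) (F Y v N k x)%:E < +oo)%E.
  apply: le_lt_trans vfin; apply: ge0_le_integral => //.
  - by move=> x Dx; rewrite lee_fin F0 ?Y01 ?v0.
  - exact: mF.
  - exact/measurable_EFinP.
  move=> x Dx; rewrite lee_fin /F ler_piMl ?v0//.
  have /andP[Y0 Y1] := Y01 x Dx; rewrite mulr_ile1 ?exprn_ge0 ?subr_ge0//.
    by rewrite exprn_ile1 ?subr_ge0// lerBlDr lerDl.
  by rewrite exprn_ile1.
have main N k : (\int[mu]_(x in D) (F X u N k x)%:E = \int[mu]_(x in D) (F Y v N k x)%:E)%E.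
  elim: N k => [|N IH] k.
    rewrite (eq_integral (fun x => (X x ^+ k * u x)%:E)); last first.
      by move=> x _; rewrite /F expr0 mul1r.
    by rewrite XY; apply: eq_integral => x _; rewrite /F expr0 mul1r.
  have := IH k; rewrite (rec X u)// (rec Y v)// IH => H.
  (* Cancelling in the extended reals needs a finite term. Finiteness comes from [v]; the induction
     hypothesis has already replaced the matching integral for [u] by this one. *)
  have fin : (\int[mu]_(x in D) (F Y v N k.+1 x)%:E)%E \is a fin_num.
    rewrite ge0_fin_numE//; apply: integral_ge0 => x Dx.
    by rewrite lee_fin F0 ?Y01 ?v0.
  by rewrite -[LHS](addeK _ fin) H addeK.
move=> N; have := main N 0%N.
rewrite (eq_integral (fun x => ((1 - X x) ^+ N * u x)%:E)); last first.
  by move=> x _; rewrite /F expr0 mulr1.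
by move=> ->; apply: eq_integral => x _; rewrite /F expr0 mulr1.
Qed.

End Moments.

(** * Bumps around a point *)

Section Concentration.
Context {R : realType}.
Notation plane := (measurableTypeR R * measurableTypeR R)%type.
Implicit Types (z : Cplx R) (p : R) (f phi : Cplx R -> Cplx R).

Lemma ccont_rcont_cabs f z : ccont f z -> rcont (fun w => cabs (f w)) z.
Proof.
move=> fz e e0; have [d d0 H] := fz e e0; exists d => // w /H.
exact: le_lt_trans (ler_cabs_dist _ _).
Qed.

Lemma analytic_ccont f z : analytic f -> disk z -> ccont f z.
Proof. by move=> fa z1; apply: cdiff_cont (derivable_cdiff (fa z z1)). Qed.

Lemma disk_near z : disk z ->
  exists2 d : R, 0 < d & forall w, cabs (w - z) < d -> disk w.
Proof.
by rewrite disk_cball => /cball_open.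
Qed.

Lemma analytic_derive1_ccont f z : analytic f -> disk z -> ccont (derive1 f) z.
Proof.
move=> fa /disk_near[d d0 H]; apply: (@derive1_ccont _ _ _ d) => // w /H.
exact: fa.
Qed.

Lemma cabs_measurable f : (forall z, disk z -> ccont f z) ->
  measurable_fun (xy_to_C @^-1` disk : set plane) (fun w : plane => cabs (f (xy_to_C w))).
Proof.
move=> fc; apply: (@rcont_measurable R (fun z => cabs (f z))).
  by move=> z; exact: disk_near.
by move=> z z1; apply/ccont_rcont_cabs/fc.
Qed.

Lemma powR_measurable d (T : measurableType d) (D : set T) (g : T -> R) s :
  measurable_fun D g -> measurable_fun D (fun x => g x `^ s).
Proof.
by move=> mg; apply: (@measurableT_comp _ _ _ _ _ _ (@powR R ^~ s)).
Qed.

Lemma density_measurable p f : analytic f ->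
  measurable_fun (xy_to_C @^-1` disk : set plane)
    (fun w : plane => cabs (derive1 f (xy_to_C w)) `^ p * weight p (xy_to_C w)).
Proof.
move=> fa; apply: measurable_funM; last exact: weight_measurable.
apply: powR_measurable; apply: cabs_measurable => z.
exact: analytic_derive1_ccont.
Qed.

Definition bump p (N : nat) (t : R) : R := (1 - (t / 2) `^ p) ^+ N.

Lemma bump_base p (t : R) : 0 <= p -> 0 <= t <= 2 -> 0 <= (t / 2) `^ p <= 1.
Proof.
move=> p0 /andP[t0 t2]; rewrite powR_ge0/=.
have := @ge0_ler_powR R p p0 (t / 2) 1; rewrite powR1; apply; rewrite ?nnegrE//.
  by rewrite divr_ge0.
by rewrite ler_pdivrMr// mul1r.
Qed.

Lemma bump_ge0 p N (t : R) : 0 <= p -> 0 <= t <= 2 -> 0 <= bump p N t.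
Proof.
move=> p0 t2; have /andP[_ ?] := bump_base p0 t2.
by rewrite exprn_ge0// subr_ge0.
Qed.

Lemma bump_anti p N (s t : R) : 0 <= p -> 0 <= s -> s <= t -> t <= 2 ->
  bump p N t <= bump p N s.
Proof.
move=> p0 s0 st t2.
have t02 : 0 <= t <= 2 by rewrite (le_trans s0 st).
have s02 : 0 <= s <= 2 by rewrite s0 (le_trans st t2).
have /andP[_ T1] := bump_base p0 t02; have /andP[_ S1] := bump_base p0 s02.
apply: lerXn2r; rewrite ?nnegrE ?subr_ge0//.
rewrite lerD2l lerN2 ge0_ler_powR ?nnegrE ?divr_ge0 ?(le_trans s0 st)//.
by rewrite ler_pM2r.
Qed.

Lemma bump_measurable d (T : measurableType d) (D : set T) p N (g : T -> R) :
  measurable_fun D g -> measurable_fun D (fun x => bump p N (g x)).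
Proof.
move=> mg; apply: measurable_funX; apply: measurable_funB => //.
by apply: powR_measurable; apply: measurable_funM.
Qed.

(** Bernoulli: [(1 - x)^6 >= 1 - 6 x > 1 - 7 x = tau] for [x = (1 - tau) / 7]. The exponent 6 is the
    total loss of powers of [eta] in [slack_gap]. *)
Lemma slack_exists (tau : R) : 0 <= tau < 1 -> exists2 eta : R, 0 < eta < 1 & tau < eta ^+ 6.
Proof.
move=> /andP[t0 t1]; exists (1 - (1 - tau) / 7); first by lra.
set x := (1 - tau) / 7; have x0 : 0 < x by rewrite /x; lra.
have x1 : x < 1 / 6 by rewrite /x; lra.
have xE : x = (1 - tau) / 7 by [].
clearbody x.
have bern n : 1 - n%:R * x <= (1 - x) ^+ n.
  elim: n => [|n IH]; first by rewrite mul0r subr0 expr0.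
  have y0 : 0 <= 1 - x by lra.
  have := ler_wpM2l y0 IH; rewrite -exprS.
  have : 0 <= n%:R * x * x by rewrite !mulr_ge0 ?ler0n ?(ltW x0).
  by rewrite -natr1; lra.
by apply: lt_le_trans (bern 6); lra.
Qed.

(** Used to make the bump outside a ball, of order [q ^+ N], negligible against its mass inside, at
    least of order [q' ^+ N]. *)
Lemma geometric_domination (c C q q' : R) : 0 < c -> 0 <= q -> q < q' ->
  exists N, C * q ^+ N < c * q' ^+ N.
Proof.
move=> c0 q0 qq'; have q'0 : 0 < q' by lra.
pose r := q / q'.
have r0 : 0 <= r by rewrite divr_ge0// ltW.
have r1 : r < 1 by rewrite ltr_pdivrMr// mul1r.
have : (fun N => C * r ^+ N) @ \oo --> C * 0.
  by apply: cvgMr; apply: cvg_expr; rewrite ger0_norm.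
rewrite mulr0 => /cvgrPdist_lt/(_ _ c0)[N _ /(_ N (leqnn N))] /=.
rewrite sub0r normrN => /(le_lt_trans (ler_norm _)) H; exists N.
have qE : q ^+ N = r ^+ N * q' ^+ N by rewrite -exprMn divfK// gt_eqF.
by rewrite qE mulrA ltr_pM2r// exprn_gt0.
Qed.

(** Brings the bump around [b] at scale [k] and the bump around [a] at scale 1 to the same centred
    integral, which makes their masses comparable. *)
Lemma cball_bump_integral p N (q b : Cplx R) (r : R) : 0 < p -> q != 0 ->
  cabs q * r <= 2 ->
  (\int[area]_(w in (xy_to_C @^-1` cball b r : set plane))
     (bump p N (cabs q * cabs (xy_to_C w - b)))%:E =
   (cabs q ^- 2)%:E * \int[area]_(w in (xy_to_C @^-1` cball 0 (cabs q * r) : set plane))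
     (bump p N (cabs (xy_to_C w)))%:E)%E.
Proof.
move=> p0 q0 qr.
have cq0 : 0 < cabs q by rewrite cabs_gt0.
have E (w : plane) : cabs (xy_to_C (simil q (- (q * b)) w)) = cabs q * cabs (xy_to_C w - b).
  by rewrite similE -mulrBr cabsM.
have f0 (w : plane) : (xy_to_C @^-1` cball 0 (cabs q * r)) w ->
    (0 <= (bump p N (cabs (xy_to_C w)))%:E)%E.
  rewrite /preimage /cball /mkset subr0 => wr.
  rewrite lee_fin bump_ge0 ?(ltW p0)// cabs_ge0/=.
  exact: le_trans (ltW wr) qr.
have mf : measurable_fun (xy_to_C @^-1` cball 0 (cabs q * r) : set plane)
    (fun w : plane => (bump p N (cabs (xy_to_C w)))%:E).
  apply/measurable_EFinP; apply: bump_measurable.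
  apply: (@rcont_measurable R (@cabs R)); first exact: cball_open.
  by move=> z _; apply: ccont_rcont_cabs => e e0; exists e.
apply: etrans (area_simil (- (q * b)) q0 (cball_measurable _ _) mf f0).
have -> : (xy_to_C @^-1` cball b r : set plane) =
    simil q (- (q * b)) @^-1` (xy_to_C @^-1` cball 0 (cabs q * r)).
  by apply/seteqP; split => w; rewrite /preimage /cball /mkset subr0 E ltr_pM2l.
by apply: eq_integral => w _; rewrite E.
Qed.

End Concentration.

(** * Reverse Schwarz-Pick inequality *)

Section ReverseSchwarzPick.
Context {R : realType}.
Notation plane := (measurableTypeR R * measurableTypeR R)%type.
Implicit Types (z : Cplx R) (p : R) (f phi : Cplx R -> Cplx R).

(** Each bound holds at [b] with room to spare because [eta < 1], so it persists nearby. Since bumps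
    decrease with the distance, the upper bound on [|f z - f b|] bounds the bump at [f z] from
    below. *)
Lemma near_distortion f g b (eta : R) : disk b -> cdiff f b (g b) -> ccont g b ->
  0 < eta < 1 -> g b != 0 ->
  exists2 r : R, 0 < r & forall z, cabs (z - b) < r ->
    [/\ disk z, cabs (f z - f b) <= cabs (g b) / eta * cabs (z - b),
        eta * cabs (g b) <= cabs (g z) &
        1 - cabs z ^+ 2 <= (1 - cabs b ^+ 2) / eta].
Proof.
move=> b1 fb gb /andP[eta0 eta1] gb0; set d := cabs (g b).
have d0 : 0 < d by rewrite cabs_gt0.
have B0 : 0 < 1 - cabs b ^+ 2 by rewrite subr_gt0; exact: disk_sqr_lt1.
have gap x : 0 < x -> 0 < x / eta - x.
  by move=> x0; rewrite subr_gt0 ltr_pdivlMr// gtr_pMr.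
have [r1 r10 H1] := disk_near b1.
have [r2 r20 H2] := fb _ (gap d d0).
have de0 : 0 < d - eta * d by rewrite subr_gt0 gtr_pMl.
have [r3 r30 H3] := ccont_rcont_cabs gb de0.
have idc : ccont (@id (Cplx R)) b by move=> k k0; exists k.
have B20 : 0 < ((1 - cabs b ^+ 2) / eta - (1 - cabs b ^+ 2)) / 2.
  by rewrite divr_gt0// gap.
exists (Num.min (Num.min r1 r2) (Num.min r3 (((1 - cabs b ^+ 2) / eta - (1 - cabs b ^+ 2)) / 2))).
  by rewrite !lt_min r10 r20 r30.
move=> z; rewrite !lt_min => /andP[/andP[/H1 z1 /H2 {}H2] /andP[/H3 {}H3 zB]].
split => //.
- have := cabsD (f z - f b - g b * (z - b)) (g b * (z - b)).
  by rewrite subrK cabsM -/d; lra.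
- by move: H3; rewrite ltr_norml -/d => /andP[+ _]; lra.
have N := ler_cabs_dist b z; rewrite cabsC in N.
have c1 : cabs b + cabs z <= 2 by rewrite ltW// (splitr 2) divff// ltrD.
have c0 : 0 <= cabs b + cabs z by rewrite addr_ge0 ?cabs_ge0.
have : cabs b ^+ 2 - cabs z ^+ 2 <= cabs (z - b) * 2.
  rewrite subr_sqr; apply: le_trans (ler_norm _) _.
  by rewrite normrM (ger0_norm c0) ler_pM.
lra.
Qed.

Lemma near_weight (a : Cplx R) (eta : R) : disk a -> 0 < eta < 1 ->
  exists2 r : R, 0 < r & forall z, cabs (z - a) < r ->
    disk z /\ eta * (1 - cabs a ^+ 2) <= 1 - cabs z ^+ 2.
Proof.
move=> a1 /andP[eta0 eta1].
have A0 : 0 < 1 - cabs a ^+ 2 by rewrite subr_gt0; exact: disk_sqr_lt1.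
have [r1 r10 H1] := disk_near a1.
have A20 : 0 < ((1 - cabs a ^+ 2) - eta * (1 - cabs a ^+ 2)) / 2.
  by rewrite divr_gt0// subr_gt0 gtr_pMl.
exists (Num.min r1 (((1 - cabs a ^+ 2) - eta * (1 - cabs a ^+ 2)) / 2)).
  by rewrite lt_min r10.
move=> z; rewrite lt_min => /andP[/H1 z1 zA]; split => //.
have N := ler_cabs_dist z a.
have c1 : cabs z + cabs a <= 2 by rewrite ltW// (splitr 2) divff// ltrD.
have c0 : 0 <= cabs z + cabs a by rewrite addr_ge0 ?cabs_ge0.
have : cabs z ^+ 2 - cabs a ^+ 2 <= cabs (z - a) * 2.
  rewrite subr_sqr; apply: le_trans (ler_norm _) _.
  by rewrite normrM (ger0_norm c0) ler_pM.
lra.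
Qed.

Lemma disk_dist_le2 z w : disk z -> disk w -> 0 <= cabs (z - w) <= 2.
Proof.
move=> z1 w1; rewrite cabs_ge0/=; apply: le_trans (cabsD _ _) _.
by rewrite cabsN ltW// (splitr 2) divff// ltrD.
Qed.

Lemma bump_disk_measurable p N f (a : Cplx R) : (forall z, disk z -> ccont f z) ->
  measurable_fun (xy_to_C @^-1` disk : set plane)
    (fun w : plane => bump p N (cabs (f (xy_to_C w) - a))).
Proof.
move=> fc; apply: bump_measurable; apply: (@cabs_measurable R (fun z => f z - a)).
move=> z /fc fz e e0; have [d d0 H] := fz e e0; exists d => // w /H.
by rewrite opprB addrA subrK.
Qed.

(** On the ball of half the radius the bump is at least its value at distance [r / 2]. The integral
    is exhibited as a real number so that it can be subtracted later. *)
Lemma bump_center_integral p N (r : R) : 0 < p -> 0 < r <= 2 ->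
  exists2 j : R, (\int[area]_(w in (xy_to_C @^-1` cball 0 r : set plane))
     (bump p N (cabs (xy_to_C w)))%:E = j%:E)%E &
    (1 - (r / 4) `^ p) ^+ N * ((r / 2) ^+ 2 * fine (@disk_area R)) <= j.
Proof.
move=> p0 /andP[r0 r2].
have /andP[a0 ay] := @disk_area_bounds R.
have aE : (@disk_area R) = (fine (@disk_area R))%:E.
  by rewrite fineK// ge0_fin_numE// ltW.
have r20 : 0 < r / 2 by rewrite divr_gt0.
have mb (D : set plane) : measurable_fun D (fun w : plane => bump p N (cabs (xy_to_C w))).
  apply: measurable_funTS; apply: bump_measurable.
  have := @rcont_measurable R (@cabs R) setT; rewrite preimage_setT; apply.
    by move=> z _; exists 1.
  by move=> z _; apply: ccont_rcont_cabs => e e0; exists e.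
have b0 (w : plane) : cball 0 r (xy_to_C w) -> 0 <= cabs (xy_to_C w) <= 2.
  by rewrite /cball /mkset subr0 cabs_ge0 => /ltW wr; exact: le_trans wr r2.
set J := (\int[area]_(w in _) _)%E.
have J0 : (0 <= J)%E.
  by apply: integral_ge0 => w /b0 wr; rewrite lee_fin bump_ge0// ltW.
have Jfin : (J < +oo)%E.
  apply: (@le_lt_trans _ _ (\int[area]_(w in (xy_to_C @^-1` cball 0 r : set plane)) (cst 1%E w))%E).
    apply: ge0_le_integral => //.
    - exact: cball_measurable.
    - by move=> w /b0 wr; rewrite lee_fin bump_ge0// ltW.
    - exact/measurable_EFinP.
    - move=> w /b0 wr; rewrite lee_fin.
      have /andP[u0 u1] := bump_base (ltW p0) wr.
      by rewrite exprn_ile1 ?subr_ge0// lerBlDr lerDl.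
  rewrite integral_cst; last exact: cball_measurable.
  by rewrite mul1e area_cball// aE -EFinM ltry.
exists (fine J); first by rewrite fineK// ge0_fin_numE.
rewrite -lee_fin fineK ?ge0_fin_numE//.
apply: (@le_trans _ _ (\int[area]_(w in (xy_to_C @^-1` cball 0 (r / 2) : set plane))
    (bump p N (cabs (xy_to_C w)))%:E)%E); last first.
  apply: ge0_subset_integral => //.
  - exact: cball_measurable.
  - exact: cball_measurable.
  - exact/measurable_EFinP.
  - by move=> w /b0 wr; rewrite lee_fin bump_ge0// ltW.
  - by move=> w; rewrite /preimage /cball /mkset subr0; lra.
apply: (@le_trans _ _ (\int[area]_(w in (xy_to_C @^-1` cball 0 (r / 2) : set plane))
    (cst ((1 - (r / 4) `^ p) ^+ N)%:E w))%E).
  rewrite integral_cst; last exact: cball_measurable.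
  by rewrite area_cball// aE -!EFinM.
have r4 : r / 4 = r / 2 / 2 by field.
have rr : 0 <= r / 2 <= 2 by apply/andP; split; lra.
apply: ge0_le_integral => //.
- exact: cball_measurable.
- by move=> w _; rewrite lee_fin r4; apply: (bump_ge0 N (ltW p0) rr).
- exact/measurable_EFinP.
- move=> w; rewrite /preimage /cball /mkset subr0 => wr; rewrite lee_fin r4.
  by apply: bump_anti; rewrite ?cabs_ge0 ?(ltW p0) ?(ltW wr)//; lra.
Qed.

(** The right side equals [eta^4 * (d * B)]^ (p - 2)[. With]tau[the power in the hypothesis, the
    left side is at most]eta^-2 * tau * (d * B) [^ (p - 2)], since [A]^ (p - 2) = tau * (d * B)
    [^ (p - 2)]. Hence [tau < eta^6] is exactly what is used. *)
Lemma slack_gap p (d A B eta : R) : 0 <= p -> p < 2 -> 0 < d -> 0 < A -> 0 < B ->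
  0 < eta < 1 -> (d * B / A) `^ (2 - p) < eta ^+ 6 ->
  (eta * A) `^ (p - 2) < (eta * d) `^ p * (B / eta) `^ (p - 2) / (d / eta) ^+ 2.
Proof.
move=> p0 p2 d0 A0 B0 /andP[eta0 eta1] taueta; set tau := _ `^ _ in taueta.
have nz := (gt_eqF d0, gt_eqF A0, gt_eqF B0, gt_eqF eta0).
have dB0 : 0 < d * B by rewrite mulr_gt0.
have ed0 : 0 < eta * d by rewrite mulr_gt0.
have E1 : (eta * d) `^ p * (B / eta) `^ (p - 2) / (d / eta) ^+ 2 =
    eta ^+ 4 * (d * B) `^ (p - 2).
  have E2 : (eta * d) `^ p = (eta * d) `^ (p - 2) * (eta * d) ^+ 2.
    rewrite -(powR_mulrn 2 (ltW ed0)) -powRD; first by rewrite subrK.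
    by apply/implyP => _; rewrite gt_eqF.
  have E3 : (eta * d) `^ (p - 2) * (B / eta) `^ (p - 2) = (d * B) `^ (p - 2).
    rewrite -powRM ?(ltW ed0)// ?divr_ge0 ?(ltW B0) ?(ltW eta0)//.
    by congr (_ `^ _); field; rewrite nz.
  rewrite E2 -E3; move: ((eta * d) `^ (p - 2)) ((B / eta) `^ (p - 2)) => x y.
  by field; rewrite !nz.
have E4 : (eta * A) `^ (p - 2) = eta `^ (p - 2) * A `^ (p - 2).
  by rewrite powRM ?(ltW eta0) ?(ltW A0).
have E5 : (d * B) `^ (p - 2) * tau = A `^ (p - 2).
  have e2p : 2 - p = - (p - 2) by ring.
  rewrite /tau (@powRM _ (d * B) A^-1) ?invr_ge0 ?(ltW dB0) ?(ltW A0)// mulrA -powRD; last first.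
    by apply/implyP => _; rewrite gt_eqF.
  rewrite e2p subrr powRr0 mul1r -powR_inv1 ?(ltW A0)// -powRrM.
  by congr (_ `^ _); ring.
have T0 : 0 < (d * B) `^ (p - 2) by rewrite powR_gt0.
have tau0 : 0 <= tau by exact: powR_ge0.
rewrite E1 E4 -E5.
have e2 : eta `^ (p - 2) <= eta ^- 2.
  apply: (@le_trans _ _ (eta `^ (- 2))).
    by apply: ger_powR; [rewrite eta0 ltW|lra].
  have -> : eta `^ (- 2) = eta ^- 2 by rewrite powRN (powR_mulrn 2 (ltW eta0)).
  exact: lexx.
apply: (@le_lt_trans _ _ (eta ^- 2 * ((d * B) `^ (p - 2) * tau))).
  by rewrite ler_wpM2r// mulr_ge0// ltW.
rewrite mulrC -mulrA [X in _ < X]mulrC ltr_pM2l// ltr_pdivrMr ?exprn_gt0//.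
by rewrite -exprD.
Qed.

(* Near [b] the push-forward of [|phi'|^p (1-|z|^2)^(p-2) dA] has density at
   least [(|phi'(b)| (1-|b|^2))^(p-2)] at [a = phi b]; comparing with the
   density [(1-|a|^2)^(p-2)] through bumps concentrating at [a] gives the claim
   because [p < 2]. *)
Lemma reverse_schwarz_pick p phi b : 1 < p < 2 -> analytic phi ->
  (forall z, disk z -> disk (phi z)) -> disk b -> derive1 phi b != 0 ->
  (forall N, \int[area]_(w in (xy_to_C @^-1` disk : set plane))
      (bump p N (cabs (phi (xy_to_C w) - phi b)) *
       (cabs (derive1 phi (xy_to_C w)) `^ p * weight p (xy_to_C w)))%:E =
    \int[area]_(w in (xy_to_C @^-1` disk : set plane))
      (bump p N (cabs (xy_to_C w - phi b)) * weight p (xy_to_C w))%:E)%E ->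
  1 - cabs (phi b) ^+ 2 <= cabs (derive1 phi b) * (1 - cabs b ^+ 2).
Proof.
move=> /andP[p1 p2] pa pd b1 db0 eqN; rewrite leNgt; apply/negP => lt1.
have p0 : 0 < p by lra.
have p20 : p - 2 <= 0 by rewrite subr_le0 ltW.
set a := phi b in eqN lt1; have a1 : disk a by exact: pd.
set d := cabs (derive1 phi b) in lt1.
have d0 : 0 < d by rewrite cabs_gt0.
set A := 1 - cabs a ^+ 2 in lt1; set B := 1 - cabs b ^+ 2 in lt1.
have A0 : 0 < A by rewrite subr_gt0; exact: disk_sqr_lt1.
have B0 : 0 < B by rewrite subr_gt0; exact: disk_sqr_lt1.
have dB0 : 0 < d * B by rewrite mulr_gt0.
pose tau := (d * B / A) `^ (2 - p).
have tau01 : 0 <= tau < 1.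
  rewrite powR_ge0/=; have := @gt0_ltr_powR R (2 - p) _ (d * B / A) 1.
  rewrite powR1; apply; rewrite ?nnegrE ?subr_gt0// ?ltr_pdivrMr ?mul1r//.
  by rewrite divr_ge0 ?ltW.
have [eta /andP[eta0 eta1] taueta] := slack_exists tau01.
have eta01 : 0 < eta < 1 by rewrite eta0.
have [r r0 Hr] := near_distortion b1 (derivable_cdiff (pa b b1)) (analytic_derive1_ccont pa b1) eta01 db0.
have [s s0 Hs] := near_weight a1 eta01.
(* Near [b] the map expands distances from [b] by at most [k] and the density is at least [m]; near
   [a] the weight is at most [M]. Rescaling by [k] divides area by [k^2], so the contradiction comes
   from [M < m / k^2]. *)
pose k := d / eta; have k0 : 0 < k by rewrite divr_gt0.
pose m := (eta * d) `^ p * (B / eta) `^ (p - 2).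
have m0 : 0 <= m by rewrite mulr_ge0 ?powR_ge0.
pose M := (eta * A) `^ (p - 2).
have M0 : 0 <= M by exact: powR_ge0.
have mM : 0 < m / k ^+ 2 - M by rewrite subr_gt0; exact: (slack_gap (ltW p0) p2 d0 A0 B0 eta01 taueta).
have {}Hr z : cabs (z - b) < r -> [/\ disk z, cabs (phi z - a) <= k * cabs (z - b),
    eta * d <= cabs (derive1 phi z) & 1 - cabs z ^+ 2 <= B / eta] := Hr z.
have {}Hs z : cabs (z - a) < s -> disk z /\ eta * A <= 1 - cabs z ^+ 2 := Hs z.
clear taueta tau01; clearbody tau k d A B.
(* [k * r' <= 1] keeps the scaled distance in the range where bumps are nonnegative and decreasing.
   Below, [s' <= k * r'] ensures that the ball around [b], once rescaled, contains the ball of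
   radius [s']. *)
pose r' := Num.min r k^-1; have r'0 : 0 < r' by rewrite lt_min r0 invr_gt0.
have kr' : k * r' <= 1.
  by rewrite -(@divff _ k) ?gt_eqF// ler_pM2l// ge_min lexx orbT.
pose s' := Num.min s (k * r').
have s'0 : 0 < s' by rewrite lt_min s0 mulr_gt0.
have s'1 : s' <= 1 by rewrite (le_trans _ kr')// ge_min lexx orbT.
have s'k : s' <= k * r' by rewrite ge_min lexx orbT.
have s's : s' <= s by rewrite ge_min lexx.
have r'r : r' <= r by rewrite ge_min lexx.
clearbody r' s'.
have mW := @weight_measurable R p.
have wfin := @weight_integrable R p; rewrite p1 p2 in wfin.
pose Cw := fine (\int[area]_(w in (xy_to_C @^-1` disk : set plane)) (weight p (xy_to_C w))%:E)%E.
have CwE : (\int[area]_(w in (xy_to_C @^-1` disk : set plane)) (weight p (xy_to_C w))%:E = Cw%:E)%E.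
  rewrite fineK// ge0_fin_numE ?wfin//; apply: integral_ge0 => w _.
  by rewrite lee_fin weight_ge0.
have Da : xy_to_C @^-1` cball a s' `<=` (xy_to_C @^-1` disk : set plane).
  by move=> w ws; case: (Hs (xy_to_C w)) => //; exact: lt_le_trans ws s's.
have Db : xy_to_C @^-1` cball b r' `<=` (xy_to_C @^-1` disk : set plane).
  by move=> w wr; case: (Hr (xy_to_C w)) => //; exact: lt_le_trans wr r'r.
have mb N := @bump_disk_measurable p N id a (fun z _ e e0 => ex_intro2 _ _ e e0 (fun w we => we)).
have mbphi N := @bump_disk_measurable p N phi a (fun z => analytic_ccont pa).
have crk0 : cr k != 0 by rewrite -cabs_eq0 cabs_cr normr_eq0 gt_eqF.
have ck : cabs (cr k) = k by rewrite cabs_cr gtr0_norm.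
(* Bases of the bump at distances [s'] and [s' / 2]: [q ^+ N] bounds it outside the ball around [a],
   [q' ^+ N] bounds it below on the half-size ball. *)
pose q := 1 - (s' / 2) `^ p; pose q' := 1 - (s' / 4) `^ p.
have s'2 : 0 <= s' <= 2 by rewrite (ltW s'0) (le_trans s'1)// ler1n.
have q0 : 0 <= q by have /andP[_] := bump_base (ltW p0) s'2; rewrite subr_ge0.
have qq' : q < q'.
  rewrite /q /q' ltrD2l ltrN2; apply: gt0_ltr_powR => //; rewrite ?nnegrE ?divr_ge0 ?(ltW s'0)//.
  by rewrite ltr_pM2l// ltf_pV2 ?posrE// ltr_nat.
have c0 : 0 < (m / k ^+ 2 - M) * ((s' / 2) ^+ 2 * fine (@disk_area R)).
  rewrite !mulr_gt0// ?exprn_gt0// ?divr_gt0//.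
  by have := @disk_area_bounds R => /fine_gt0.
have [N HN] := geometric_domination Cw c0 q0 qq'.
have [|j jE jlow] := @bump_center_integral p N s' p0; first by rewrite s'0 (le_trans s'1)// ler1n.
have le2 z w : disk z -> disk w -> 0 <= cabs (z - w) <= 2 := @disk_dist_le2 z w.
have lower : ((m / k ^+ 2 * j)%:E <=
   \int[area]_(w in (xy_to_C @^-1` disk : set plane))
      (bump p N (cabs (phi (xy_to_C w) - a)) *
       (cabs (derive1 phi (xy_to_C w)) `^ p * weight p (xy_to_C w)))%:E)%E.
  have mdens := density_measurable p pa.
  apply: (@le_trans _ _ (\int[area]_(w in (xy_to_C @^-1` cball b r' : set plane))
      (bump p N (cabs (phi (xy_to_C w) - a)) *
       (cabs (derive1 phi (xy_to_C w)) `^ p * weight p (xy_to_C w)))%:E)%E); last first.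
    apply: ge0_subset_integral => //.
    - exact: cball_measurable.
    - exact: pdisk_measurable.
    - by apply/measurable_EFinP; apply: measurable_funM.
    - move=> w w1; rewrite lee_fin !mulr_ge0 ?powR_ge0//.
      by apply: bump_ge0; [exact: ltW|exact/le2/a1/pd].
  have mbk : measurable_fun (xy_to_C @^-1` cball b r' : set plane)
      (fun w : plane => (bump p N (k * cabs (xy_to_C w - b)))%:E).
    apply/measurable_EFinP; apply: bump_measurable; apply: measurable_funM => //.
    apply: (@rcont_measurable R (fun z => cabs (z - b))); first exact: cball_open.
    move=> z _ e e0; exists e => // w we; apply: le_lt_trans (ler_cabs_dist _ _) _.
    by rewrite opprB addrA subrK.
  have kz (w : plane) : cball b r' (xy_to_C w) -> 0 <= k * cabs (xy_to_C w - b) <= 2.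
    move=> wr; rewrite mulr_ge0 ?cabs_ge0 ?(ltW k0)//=.
    apply: (le_trans (ler_wpM2l (ltW k0) (ltW wr))).
    by rewrite (le_trans kr')// ler1n.
  apply: (@le_trans _ _ (\int[area]_(w in (xy_to_C @^-1` cball b r' : set plane))
      (m%:E * (bump p N (k * cabs (xy_to_C w - b)))%:E))%E).
    rewrite ge0_integralZl//; first last.
    - by move=> w wr; rewrite lee_fin; apply: (bump_ge0 N (ltW p0)); exact: kz.
    - exact: cball_measurable.
    have := @cball_bump_integral R p N (cr k) b r' p0 crk0; rewrite ck => -> //; last first.
      by rewrite (le_trans kr')// ler1n.
    rewrite muleA -EFinM (_ : (m / k ^+ 2 * j)%:E = ((m / k ^+ 2)%:E * j%:E)%E)//.
    apply: lee_wpmul2l; first by rewrite lee_fin divr_ge0// sqr_ge0.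
    rewrite -jE; apply: ge0_subset_integral => //.
    - exact: cball_measurable.
    - exact: cball_measurable.
    - apply/measurable_EFinP; apply: bump_measurable.
      apply: (@rcont_measurable R (@cabs R)); first exact: cball_open.
      by move=> z _; apply: ccont_rcont_cabs => e e0; exists e.
    - move=> w; rewrite /preimage /cball /mkset subr0 => wr; rewrite lee_fin.
      apply: (bump_ge0 N (ltW p0)); rewrite cabs_ge0/=.
      by rewrite (le_trans (ltW wr))// (le_trans kr')// ler1n.
    - move=> w; rewrite /preimage /cball /mkset subr0 => wr.
      exact: lt_le_trans s'k.
  apply: ge0_le_integral => //.
  - exact: cball_measurable.
  - move=> w wr; rewrite -EFinM lee_fin mulr_ge0//.
    by apply: (bump_ge0 N (ltW p0)); exact: kz.
  - by apply: measurable_funeM.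
  - apply: measurable_funS (@pdisk_measurable R) Db _.
    by apply/measurable_EFinP; apply: measurable_funM.
  move=> w wr; have [z1 h1 h2 h3] := Hr _ (lt_le_trans wr r'r).
  rewrite -EFinM lee_fin mulrC; apply: ler_pM => //.
  - by apply: (bump_ge0 N (ltW p0)); exact: kz.
  - have /andP[_ kz2] := kz w wr.
    by apply: (bump_anti N (ltW p0)); rewrite ?cabs_ge0.
  - apply: ler_pM; rewrite ?powR_ge0//.
      by apply: ge0_ler_powR; rewrite ?nnegrE ?cabs_ge0 ?mulr_ge0 ?(ltW p0) ?(ltW eta0) ?(ltW d0).
    apply: le0_ger_powR => //.
    by rewrite subr_gt0; exact: disk_sqr_lt1.
have upper : (\int[area]_(w in (xy_to_C @^-1` disk : set plane))
      (bump p N (cabs (xy_to_C w - a)) * weight p (xy_to_C w))%:E <=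
   (M * j + q ^+ N * Cw)%:E)%E.
  have mca : measurable (xy_to_C @^-1` cball a s' : set plane) := cball_measurable a s'.
  have md := @pdisk_measurable R.
  have mint : measurable_fun (xy_to_C @^-1` disk : set plane)
      (fun w : plane => (bump p N (cabs (xy_to_C w - a)) * weight p (xy_to_C w))%:E).
    by apply/measurable_EFinP; apply: measurable_funM; [exact: mb|].
  have int0 (w : plane) : (xy_to_C @^-1` disk) w ->
      (0 <= (bump p N (cabs (xy_to_C w - a)) * weight p (xy_to_C w))%:E)%E.
    move=> w1; rewrite lee_fin mulr_ge0 ?weight_ge0//.
    by apply: (bump_ge0 N (ltW p0)); exact: le2.
  (* Inside the ball the weight is replaced by [M], which gives [M * j]; outside, the bump is
     replaced by [q ^+ N], which leaves the total weight [Cw]. *)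
  rewrite -(setDUK Da) ge0_integral_setU//; first last.
  - by apply/disj_setPS => w [ws [_ nws]]; exact: nws ws.
  - by rewrite setDUK.
  - by rewrite setDUK.
  - exact: measurableD.
  rewrite EFinD; apply: leeD.
    apply: (@le_trans _ _ (\int[area]_(w in (xy_to_C @^-1` cball a s' : set plane))
      (M%:E * (bump p N (1 * cabs (xy_to_C w - a)))%:E))%E).
      apply: ge0_le_integral => //.
      - by move=> w /Da; exact: int0.
      - exact: measurable_funS mint.
      - apply: measurable_funeM; apply/measurable_EFinP.
        apply: measurable_funS md Da _; have := mb N.
        by congr measurable_fun; apply/funext => w; rewrite mul1r.
      move=> w ws; have [w1 hw] := Hs _ (lt_le_trans ws s's).
      rewrite -EFinM lee_fin mul1r mulrC ler_wpM2r//.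
        by apply: (bump_ge0 N (ltW p0)); exact: le2.
      apply: le0_ger_powR => //.
      by rewrite mulr_gt0.
    have := @cball_bump_integral R p N 1 a s' p0 (oner_neq0 _).
    rewrite cabs1 mul1r => /(_ (le_trans s'1 _)) H.
    rewrite ge0_integralZl//; first last.
    - by move=> w /Da w1; rewrite lee_fin mul1r; apply: (bump_ge0 N (ltW p0)); exact: le2.
    - apply/measurable_EFinP; apply: measurable_funS md Da _; have := mb N.
      by congr measurable_fun; apply/funext => w; rewrite mul1r.
    rewrite H ?ler1n// jE expr1n invr1 mul1e EFinM//.
  apply: (@le_trans _ _ (\int[area]_(w in (xy_to_C @^-1` disk : set plane))
      ((q ^+ N)%:E * (weight p (xy_to_C w))%:E))%E); last first.
    rewrite ge0_integralZl//.
    - by rewrite CwE EFinM.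
    - exact/measurable_EFinP.
    - by move=> w _; rewrite lee_fin weight_ge0.
    - by rewrite lee_fin exprn_ge0.
  apply: (@le_trans _ _ (\int[area]_(w in (xy_to_C @^-1` disk `\` xy_to_C @^-1` cball a s' : set plane))
      ((q ^+ N)%:E * (weight p (xy_to_C w))%:E))%E); last first.
    apply: ge0_subset_integral => //.
    - exact: measurableD.
    - by apply: measurable_funeM; exact/measurable_EFinP.
    - by move=> w _; rewrite -EFinM lee_fin mulr_ge0 ?weight_ge0 ?exprn_ge0.
  apply: ge0_le_integral => //.
  - exact: measurableD.
  - by move=> w [/int0].
  - by apply: measurable_funS mint => // w [].
  - apply: measurable_funeM; apply/measurable_EFinP.
    by apply: measurable_funS mW => // w [].
  move=> w [w1 /negP]; rewrite -leNgt => ws.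
  rewrite -EFinM lee_fin ler_wpM2r ?weight_ge0//.
  have /andP[_ d2] := le2 _ _ w1 a1.
  by apply: (bump_anti N (ltW p0)); rewrite ?(ltW s'0).
have := lower; rewrite eqN => /le_trans/(_ upper); rewrite lee_fin => H.
(* Both estimates involve the same [j], so the difference of densities multiplies it; its lower
   bound then contradicts the choice of [N]. *)
have {}H : (m / k ^+ 2 - M) * j <= q ^+ N * Cw by rewrite mulrBl lerBlDl.
have := le_trans (ler_wpM2l (ltW mM) jlow) H.
by rewrite mulrCA mulrC [q ^+ N * _]mulrC leNgt HN.
Qed.

End ReverseSchwarzPick.

(** * Isometric composition operators *)

Section BesovIsometry.
Context {R : realType}.
Notation plane := (measurableTypeR R * measurableTypeR R)%type.
Implicit Types (z a : Cplx R) (p : R) (f phi : Cplx R -> Cplx R).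

Lemma besov_integralE p f : besov_integral p f =
  (\int[area]_(w in (xy_to_C @^-1` disk : set plane))
     (cabs (derive1 f (xy_to_C w)) `^ p * weight p (xy_to_C w))%:E)%E.
Proof. by []. Qed.

Lemma besov_integral_ge0 p f : (0 <= besov_integral p f)%E.
Proof.
by apply: integral_ge0 => w _; rewrite lee_fin mulr_ge0 ?powR_ge0.
Qed.

Lemma eq_besov_integral p f (h : Cplx R -> R) :
  (forall z, disk z -> cabs (derive1 f z) `^ p = h z) ->
  besov_integral p f =
  (\int[area]_(w in (xy_to_C @^-1` disk : set plane)) (h (xy_to_C w) * weight p (xy_to_C w))%:E)%E.
Proof.
by move=> fh; apply: eq_integral => w /set_mem w1; rewrite fh.
Qed.

Lemma analytic_comp f phi : analytic phi -> (forall z, disk z -> disk (phi z)) ->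
  analytic f -> analytic (f \o phi) /\
  forall z, disk z -> derive1 (f \o phi) z = derive1 f (phi z) * derive1 phi z.
Proof.
move=> pa pd fa; suff H z : disk z -> derivable (f \o phi) z 1 /\
    derive1 (f \o phi) z = derive1 f (phi z) * derive1 phi z.
  by split=> z /H[].
move=> z1; apply: cdiff_derive1; apply: cdiff_comp.
  exact: derivable_cdiff (pa z z1).
exact: derivable_cdiff (fa _ (pd z z1)).
Qed.

Lemma cdiff_mull (q z : Cplx R) : cdiff (fun w => q * w) z q.
Proof.
by move=> e e0; exists 1 => // y _; rewrite -mulrBr subrr cabs0 mulr_ge0 ?cabs_ge0 ?ltW.
Qed.

(** A rotation preserves the area, the weight, the modulus of the derivative and the value at 0. *)
Lemma rotation_isometry p phi (q : Cplx R) : analytic phi ->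
  (forall z, disk z -> disk (phi z)) -> cabs q = 1 ->
  (forall z, disk z -> phi z = q * z) -> besov_isometry p (comp_op phi).
Proof.
move=> pa pd q1 pq f [fa fS].
have [ca cd] := analytic_comp pa pd fa.
have dphi z : disk z -> derive1 phi z = q.
  move=> z1; have [d d0 H] := disk_near z1.
  by have [] := cdiff_derive1 (cdiff_near d0 (fun w wd => esym (pq w (H w wd))) (cdiff_mull q z)).
have I : besov_integral p (f \o phi) = besov_integral p f.
  have q0 : q != 0 by rewrite -cabs_eq0 q1 oner_eq0.
  have md := @pdisk_measurable R.
  have mf : measurable_fun (xy_to_C @^-1` disk : set plane) (fun w : plane =>
     (cabs (derive1 f (xy_to_C w)) `^ p * weight p (xy_to_C w))%:E).
    by apply/measurable_EFinP; exact: density_measurable.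
  have f0 (w : plane) : (xy_to_C @^-1` disk) w ->
     (0 <= (cabs (derive1 f (xy_to_C w)) `^ p * weight p (xy_to_C w))%:E)%E.
    by rewrite lee_fin mulr_ge0 ?powR_ge0.
  have := area_simil 0 q0 md mf f0; rewrite q1 expr1n invr1 mul1e => E.
  rewrite [RHS]besov_integralE -E.
  have -> : simil q 0 @^-1` (xy_to_C @^-1` disk) = (xy_to_C @^-1` disk : set plane).
    by apply/seteqP; split => w; rewrite /preimage /disk /mkset similE addr0 cabsM q1 mul1r.
  rewrite besov_integralE; apply: eq_integral => w /set_mem w1.
  rewrite similE addr0 (cd _ w1) (dphi _ w1) (pq _ w1) cabsM q1 mulr1.
  rewrite /weight cabsM q1 mul1r; exact: erefl.
have S : besov_seminorm p (f \o phi) = besov_seminorm p f by rewrite /besov_seminorm I.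
split; first by split; [|rewrite /mkset S].
by rewrite /besov_norm /comp_op S /= (pq _ (@disk0 R)) mulr0.
Qed.

Definition power_fun a n z : Cplx R := (n.+1%:R * 2 ^+ n)^-1 * (z - a) ^+ n.+1.

Lemma power_fun_cdiff a n z : cdiff (power_fun a n) z (((z - a) / 2) ^+ n).
Proof.
apply/cdiffP.
have h : is_derive z 1 ((id : Cplx R -> Cplx R) - cst a) (1 - 0) by apply: is_deriveB.
have h2 := is_deriveX n.+1 h.
have h3 := is_deriveZ ((n.+1%:R * 2 ^+ n)^-1 : Cplx R) h2.
have E : power_fun a n = ((n.+1%:R * 2 ^+ n)^-1 : Cplx R) \*: (((id : Cplx R -> Cplx R) - cst a) ^+ n.+1).
  by apply/funext => w; rewrite /power_fun !fctE.
rewrite E; apply: is_derive_eq h3 _.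
rewrite !fctE subr0 -[_ *: _]/(_ * (_ * 1)) mulr1 mulrA.
have n0 : (n.+1%:R : Cplx R) != 0 by rewrite pnatr_eq0.
by rewrite expr_div_n -mulrA invfM mulrACA mulVf// mul1r mulrC.
Qed.

Lemma power_fun_analytic a n : analytic (power_fun a n).
Proof. by move=> z _; have [] := cdiff_derive1 (power_fun_cdiff a n z). Qed.

Lemma power_fun_derive1 a n z : cabs (derive1 (power_fun a n) z) = (cabs (z - a) / 2) ^+ n.
Proof.
have [_ ->] := cdiff_derive1 (power_fun_cdiff a n z).
by rewrite cabsX cabsM cabsV cabs_nat.
Qed.

Lemma expr_powR (t p : R) n : 0 <= t -> (t ^+ n) `^ p = (t `^ p) ^+ n.
Proof.
by move=> t0; rewrite -powR_mulrn// powRAC powR_mulrn// powR_ge0.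
Qed.

Lemma expr_mul_powR (t u p : R) n : 0 <= t -> 0 <= u ->
  (t ^+ n * u) `^ p = (t `^ p) ^+ n * u `^ p.
Proof. by move=> t0 u0; rewrite powRM ?exprn_ge0// expr_powR. Qed.

Lemma half_cabs_ge0 z : 0 <= cabs z / 2.
Proof. by rewrite divr_ge0 ?cabs_ge0. Qed.

Lemma power_fun_besov_integral p a n : besov_integral p (power_fun a n) =
  (\int[area]_(w in (xy_to_C @^-1` disk : set plane))
     (((cabs (xy_to_C w - a) / 2) `^ p) ^+ n * weight p (xy_to_C w))%:E)%E.
Proof.
apply: (eq_besov_integral (h := fun z => ((cabs (z - a) / 2) `^ p) ^+ n)) => z z1.
by rewrite power_fun_derive1 expr_powR ?half_cabs_ge0.
Qed.

Lemma power_fun_comp_besov_integral p a n phi : analytic phi ->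
  (forall z, disk z -> disk (phi z)) -> besov_integral p (power_fun a n \o phi) =
  (\int[area]_(w in (xy_to_C @^-1` disk : set plane))
     (((cabs (phi (xy_to_C w) - a) / 2) `^ p) ^+ n *
      (cabs (derive1 phi (xy_to_C w)) `^ p * weight p (xy_to_C w)))%:E)%E.
Proof.
move=> pa pd; have [_ cd] := analytic_comp pa pd (@power_fun_analytic a n).
rewrite (eq_besov_integral (h := fun z => ((cabs (phi z - a) / 2) `^ p) ^+ n *
    cabs (derive1 phi z) `^ p)).
  by apply: eq_integral => w _; rewrite mulrA.
move=> z z1.
have E : cabs (derive1 (power_fun a n \o phi) z) =
    (cabs (phi z - a) / 2) ^+ n * cabs (derive1 phi z).
  apply: etrans (congr1 (@cabs R) (cd _ z1)) _; apply: etrans (cabsM _ _) _.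
  exact: (congr1 (fun x : R => x * cabs (derive1 phi z)) (power_fun_derive1 a n (phi z))).
apply: etrans (congr1 (fun x => x `^ p) E) _.
exact: expr_mul_powR (half_cabs_ge0 _) (cabs_ge0 _).
Qed.

(** On the disk the derivative has modulus at most 1, so the integral is dominated by that of the
    weight. *)
Lemma power_fun_besov p a n : 1 < p < 2 -> disk a -> besov p (power_fun a n).
Proof.
move=> p12 a1; split; first exact: power_fun_analytic.
have p0 : 0 <= p by case/andP: p12; lra.
rewrite /mkset /besov_seminorm; apply: poweR_lty.
apply: le_lt_trans (weight_integrable p12); rewrite power_fun_besov_integral.
have mw := @weight_measurable R p.
apply: ge0_le_integral => //.
- exact: pdisk_measurable.
- by move=> w _; rewrite lee_fin mulr_ge0 ?weight_ge0// exprn_ge0// powR_ge0.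
- apply/measurable_EFinP; apply: measurable_funM => //; apply: measurable_funX.
  apply: powR_measurable; apply: measurable_funM => //.
  apply: (@cabs_measurable R (fun z => z - a)) => z _ e e0; exists e => // w we.
  by rewrite opprB addrA subrK.
- exact/measurable_EFinP.
move=> w w1; rewrite lee_fin ler_piMl ?weight_ge0// exprn_ile1 ?powR_ge0//.
by have /andP[] := bump_base p0 (disk_dist_le2 w1 a1).
Qed.

Lemma besov_integral_fin p f : 0 < p -> besov p f -> besov_integral p f \is a fin_num.
Proof.
move=> p0 [_ fS]; rewrite ge0_fin_numE ?besov_integral_ge0//.
by apply: lty_poweRy fS; rewrite invr_eq0 gt_eqF.
Qed.

Lemma besov_seminorm_inj p f g : 0 < p -> besov_seminorm p f = besov_seminorm p g ->
  besov_integral p f = besov_integral p g.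
Proof.
move=> p0 H.
have E x : (0 <= x)%E -> ((x `^ p^-1) `^ p)%E = x.
  by move=> x0; rewrite -poweRrM mulVf; [exact: poweRe1|rewrite gt_eqF].
apply: etrans (esym (E _ (besov_integral_ge0 p f))) _.
exact: etrans (congr1 (fun x => (x `^ p)%E) H) (E _ (besov_integral_ge0 p g)).
Qed.

Lemma adde_EFin_inj (r : R) (x y : \bar R) : (r%:E + x = r%:E + y)%E -> x = y.
Proof. by case: x => [x| |]; case: y => [y| |]//= [] /addrI ->. Qed.

Lemma adde_fin_sub (x1 y1 x2 y2 : R) (s t : \bar R) :
  s \is a fin_num -> t \is a fin_num ->
  (x1%:E + t = y1%:E + s)%E -> (x2%:E + t = y2%:E + s)%E -> x1 - y1 = x2 - y2.
Proof. by case: s => [s| |]//; case: t => [t| |]// _ _ [E1] [E2]; lra. Qed.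

(** All [z - a] have the same seminorm [s], and all [phi - a] the same seminorm [t]. The choices
    [a = 0] and [a = phi 0] give [|phi 0| + t = s] and [t = |phi 0| + s], whence
    [|phi 0| = - |phi 0|]. *)
Lemma isometry_fixes0 p phi : 1 < p < 2 -> analytic phi ->
  (forall z, disk z -> disk (phi z)) -> besov_isometry p (comp_op phi) -> phi 0 = 0.
Proof.
move=> p12 pa pd iso; have p0 : 0 < p by case/andP: p12; lra.
have d0 := @disk0 R; have pd0 := pd 0 d0.
have S1 a : besov_seminorm p (power_fun a 0) = besov_seminorm p (power_fun 0 0).
  by rewrite /besov_seminorm !power_fun_besov_integral; congr (_ `^ _)%E.
have S2 a : besov_seminorm p (power_fun a 0 \o phi) = besov_seminorm p (power_fun 0 0 \o phi).
  by rewrite /besov_seminorm !power_fun_comp_besov_integral//; congr (_ `^ _)%E.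
have [B1 N1] := iso _ (power_fun_besov 0 p12 d0).
have [B2 N2] := iso _ (power_fun_besov 0 p12 pd0).
move: N1 N2; rewrite /besov_norm /comp_op S1 S2.
have f1 : besov_seminorm p (power_fun 0 0) \is a fin_num.
  apply: fin_num_poweR; exact: besov_integral_fin p0 (power_fun_besov 0 p12 d0).
have f2 : besov_seminorm p (power_fun 0 0 \o phi) \is a fin_num.
  by apply: fin_num_poweR; exact: besov_integral_fin p0 B1.
move=> N1 N2; have := adde_fin_sub f1 f2 N1 N2.
have P a z : cabs (power_fun a 0 z) = cabs (z - a).
  by rewrite /power_fun !expr1 expr0 mulr1 invr1 mul1r.
rewrite /comp !P !subr0 subrr cabs0 !sub0r cabsN => H.
by apply/eqP; rewrite -cabs_eq0; apply/eqP; lra.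
Qed.

Lemma isometry_bump p phi : 1 < p < 2 -> analytic phi ->
  (forall z, disk z -> disk (phi z)) -> besov_isometry p (comp_op phi) ->
  forall a N, disk a -> (\int[area]_(w in (xy_to_C @^-1` disk : set plane))
      (bump p N (cabs (phi (xy_to_C w) - a)) *
       (cabs (derive1 phi (xy_to_C w)) `^ p * weight p (xy_to_C w)))%:E =
    \int[area]_(w in (xy_to_C @^-1` disk : set plane))
      (bump p N (cabs (xy_to_C w - a)) * weight p (xy_to_C w))%:E)%E.
Proof.
move=> p12 pa pd iso a N a1; have p0 : 0 < p by case/andP: p12; lra.
have phi0 := isometry_fixes0 p12 pa pd iso.
have mX f : (forall z, disk z -> ccont f z) -> measurable_fun (xy_to_C @^-1` disk : set plane)
    (fun w : plane => (cabs (f (xy_to_C w) - a) / 2) `^ p).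
  move=> fc; apply: powR_measurable; apply: measurable_funM => //.
  apply: (@cabs_measurable R (fun z => f z - a)) => z /fc fz e e0.
  have [d d0 H] := fz e e0; exists d => // w /H.
  by rewrite opprB addrA subrK.
apply: (moments_onem (X := fun w : plane => (cabs (phi (xy_to_C w) - a) / 2) `^ p)
  (Y := fun w : plane => (cabs (xy_to_C w - a) / 2) `^ p)
  (u := fun w : plane => cabs (derive1 phi (xy_to_C w)) `^ p * weight p (xy_to_C w))
  (v := fun w : plane => weight p (xy_to_C w))).
- exact: pdisk_measurable.
- by apply: mX => z; exact: analytic_ccont.
- by apply: (mX id) => z _ e e0; exists e.
- exact: density_measurable.
- exact: weight_measurable.
- by move=> w w1; apply: bump_base (ltW p0) _; exact/disk_dist_le2/a1/pd.
- by move=> w w1; apply: bump_base (ltW p0) _; exact: disk_dist_le2.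
- by move=> w _; rewrite mulr_ge0 ?powR_ge0.
- by move=> w _; exact: weight_ge0.
- exact: weight_integrable.
move=> n; rewrite -power_fun_comp_besov_integral// -power_fun_besov_integral.
have fB := power_fun_besov n p12 a1.
(* Since [phi 0 = 0], the test function and its composite have the same value at 0, so equality of
   norms becomes equality of seminorms. *)
have [_] := iso _ fB; rewrite /besov_norm /comp_op /= phi0 => H.
exact: besov_seminorm_inj p0 (adde_EFin_inj H).
Qed.

Lemma isometry_nonconstant p phi : 1 < p < 2 -> analytic phi ->
  (forall z, disk z -> disk (phi z)) -> besov_isometry p (comp_op phi) ->
  exists2 b, disk b & derive1 phi b != 0.
Proof.
move=> p12 pa pd iso; have p0 : 0 < p by case/andP: p12; lra.
apply: contrapT => H.
have d0 z : disk z -> derive1 phi z = 0.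
  by move=> z1; apply/eqP/negPn/negP => dz; apply: H; exists z.
(* With [N = 0] the bump is 1: a vanishing derivative would make the integral of the weight, which
   is at least the area of the disk, equal to 0. *)
have := isometry_bump p12 pa pd iso 0 (@disk0 R).
rewrite (eq_integral (cst 0%E)); last first.
  by move=> w /set_mem w1; rewrite d0// cabs0 powR0 ?gt_eqF// mul0r mulr0.
rewrite integral0 => E.
have /andP[+ _] := @disk_area_bounds R; rewrite ltNge => /negP; apply.
rewrite [X in (_ <= X)%E]E.
apply: (@le_trans _ _ (\int[area]_(w in (xy_to_C @^-1` disk : set plane)) (cst 1%E w))%E).
  by rewrite integral_cst ?mul1e//; exact: pdisk_measurable.
have p2 : p < 2 by case/andP: p12.
apply: ge0_le_integral => //.
- exact: pdisk_measurable.
- apply/measurable_EFinP; apply: measurable_funM; last exact: weight_measurable.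
  apply: bump_measurable; apply: (@cabs_measurable R (fun z => z - 0)) => z _ e e0.
  by exists e => // w we; rewrite !subr0.
- by move=> w w1; rewrite lee_fin /bump expr0 mul1r weight_ge1.
Qed.

Lemma rcont_ray (g : Cplx R -> R) (b : Cplx R) (t : R) : rcont g (cr t * b) ->
  {for t, continuous (fun s => g (cr s * b))}.
Proof.
move=> gc; apply/cvgrPdist_lt => e e0; have [d d0 H] := gc e e0.
have b0 : 0 < cabs b + 1 by rewrite ltr_wpDl// cabs_ge0.
exists (d / (cabs b + 1)); first by rewrite /= divr_gt0.
move=> s /=; rewrite ltr_pdivlMr// distrC => st; rewrite distrC; apply: H.
rewrite -mulrBl cabsM -[cr s - cr t](rmorphB (real_complex R)) cabs_cr.
apply: le_lt_trans st; rewrite ler_wpM2l//; lra.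
Qed.

Lemma derive1_ge1_at0 p phi : 1 < p < 2 -> analytic phi ->
  (forall z, disk z -> disk (phi z)) -> besov_isometry p (comp_op phi) ->
  1 <= cabs (derive1 phi 0).
Proof.
move=> p12 pa pd iso; have phi0 := isometry_fixes0 p12 pa pd iso.
have rsp z : disk z -> derive1 phi z != 0 ->
    1 - cabs (phi z) ^+ 2 <= cabs (derive1 phi z) * (1 - cabs z ^+ 2).
  move=> z1 dz; apply: (reverse_schwarz_pick p12) => // N.
  exact: isometry_bump (pd z z1).
have [b b1 db] := isometry_nonconstant p12 pa pd iso.
have pos z : disk z -> 0 < 1 - cabs (phi z) ^+ 2.
  by move=> z1; rewrite subr_gt0; exact/disk_sqr_lt1/pd.
(* The quotient of the two sides of the reverse Schwarz-Pick inequality along the ray. It vanishes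
   where the derivative does, is at least 1 elsewhere, and equals [|phi' 0|] at [t = 0]. *)
pose u t := cabs (derive1 phi (cr t * b)) * (1 - cabs (cr t * b) ^+ 2) /
  (1 - cabs (phi (cr t * b)) ^+ 2).
have tb t : 0 <= t <= 1 -> disk (cr t * b).
  move=> /andP[t0 t1]; rewrite /disk /mkset cabsM cabs_cr ger0_norm//.
  by apply: le_lt_trans b1; rewrite ler_piMl ?cabs_ge0.
have uc t : 0 <= t <= 1 -> {for t, continuous u}.
  move=> /tb t1; apply: cvgM; last first.
    apply: cvgV; first by rewrite gt_eqF// pos.
    apply: cvgB; first exact: cvg_cst.
    by apply: cvgM; apply: (rcont_ray (g := fun z => cabs (phi z)));
      apply: ccont_rcont_cabs; exact: analytic_ccont.
  apply: cvgM; last first.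
    apply: cvgB; first exact: cvg_cst.
    by apply: cvgM; apply: (rcont_ray (g := @cabs R)) => e e0; exists e => // w;
      exact: le_lt_trans (ler_cabs_dist _ _).
  apply: (rcont_ray (g := fun z => cabs (derive1 phi z))).
  by apply: ccont_rcont_cabs; exact: analytic_derive1_ccont.
have u0 : u 0 = cabs (derive1 phi 0).
  by rewrite /u cr0 mul0r phi0 cabs0 expr0n subr0 divr1 mulr1.
have ge1 t : 0 <= t <= 1 -> derive1 phi (cr t * b) != 0 -> 1 <= u t.
  move=> t01 dt; have t1 := tb t t01.
  by rewrite /u ler_pdivlMr ?mul1r; [exact: rsp|exact: pos].
have i0 : 0 <= (0 : R) <= 1 by rewrite lexx ler01.
have i1 : 0 <= (1 : R) <= 1 by rewrite lexx ler01.
rewrite -u0 leNgt; apply/negP => u01.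
have dphi0 : derive1 phi (cr 0 * b) = 0.
  by apply/eqP/negPn/negP => /(ge1 0 i0); rewrite leNgt u01.
have u00 : u 0 = 0 by rewrite /u dphi0 cabs0 !mul0r.
have u1 : 1 <= u 1 by apply: ge1 i1 _; rewrite cr1 mul1r; exact: db.
(* If [u 0 < 1] then [u 0 = 0] while [u 1 >= 1]; the value [1 / 2] would be attained, although [u]
   only takes the value 0 or values at least 1. *)
have [||t tin ut] := @IVT R u 0 1 (1 / 2) ler01.
- apply: continuous_in_subspaceT => t /set_mem; rewrite /= in_itv /=; exact: uc.
- rewrite u00 min_l ?max_r; last by rewrite (le_trans ler01).
    by apply/andP; split; lra.
  by rewrite (le_trans ler01).
rewrite in_itv /= in tin.
have [dt|dt] := eqVneq (derive1 phi (cr t * b)) 0.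
  by move: ut; rewrite /u dt cabs0 !mul0r; lra.
by have := ge1 t tin dt; rewrite ut; lra.
Qed.

End BesovIsometry.

Theorem theorem3p6 (R : realType) (p : R) (phi : Cplx R -> Cplx R)
    (hp1 : 1 < p) (hp2 : p < 2)
    (phi_analytic : analytic phi)
    (phi_disk : forall z, disk z -> disk (phi z)) :
  besov_isometry p (comp_op phi) <->
  exists lambda : Cplx R,
    cabs lambda = 1 /\ forall z, disk z -> phi z = lambda * z.
Proof.
have p12 : 1 < p < 2 by rewrite hp1.
split=> [iso|[q [q1 pq]]]; last exact: rotation_isometry pq.
have phi0 := isometry_fixes0 p12 phi_analytic phi_disk iso.
exists (derive1 phi 0); apply: schwarz_rigidity => //.
exact: derive1_ge1_at0 p12 phi_analytic phi_disk iso.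
Qed.
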